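(* Let $\mathcal{D}$ be either a stack, a queue, a deque, a priority queue or a search tree implemented in the oblivious cell probe model and secure in the sense defined in the context, with $r$-bit elements for $r \geq 1$, and let $n$ be an upper bound on the number of elements in $\mathcal{D}$. Let $w$ denote the cell size of $\mathcal{D}$ and $m$ the client memory size in bits, and suppose $\mathcal{D}$ has failure probability at most $1/3$ per operation. Then there exists a sequence $y$ of $n$ operations such that $\mathcal{D}$ has expected amortized running time $\Omega(\lg(nr/m)\cdot r/w)$ on $y$.
   Context: Oblivious cell probe model: a data structure has a server memory of $w$-bit cells with integer addresses in $[K]$, $K \leq 2^w$, and a client memory of $m$ bits accessed for free, plus an arbitrarily long uniformly random bit string $R$ drawn independently of the operations before any operation. Operations are processed by probing (reading and/or writing) server cells; probed addresses, written contents and client-memory updates are arbitrary deterministic functions of the client memory, $R$, and contents of cells probed so far during the current operation; queries announce an answer determined by what was probed. Running time of an operation is the number of probes it makes; expected amortized running time on $y$ is the expected total number of probes divided by the length of $y$. Failure probability $\delta$ means that for every operation sequence and every query in it, the query is answered correctly with probability at least $1-\delta$. For $y=(\mathrm{op}_1,\dots,\mathrm{op}_M)$, $A(y)=(A(\mathrm{op}_1),\dots,A(\mathrm{op}_M))$ where $A(\mathrm{op}_i)$ is the list of probes (cell addresses) made while processing $\mathrm{op}_i$. Security: for any two sequences $y,z$ of equal length $M$ and any deterministic $f$ from probe sequences to $\{0,1\}$ computable in time polynomial in $M$, $w$ and the logarithm of the number of distinct possible operations, $|\Pr[f(A(y))=1]-\Pr[f(A(z))=1]|\leq 1/4$. The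 data structure problems: a stack supports $\textsc{push}(x)$ ($x\in\{0,1\}^r$) and $\textsc{pop}$ (remove and return the most recently pushed element still present); a queue supports $\textsc{enqueue}(x)$ and $\textsc{dequeue}$ (remove and return the least recently enqueued element still present); a deque supports insertion and removal (with return) at both ends; a priority queue supports inserting an element with a priority and extracting (removing and returning) the element of minimum priority; a search tree is an ordered dictionary supporting insertions, deletions and order-based lookups (e.g. predecessor/successor queries) on stored elements.
   Formalization: The Ω-constants (factor and threshold on nr/m) depend on an exponent e, assuming r ≤ m·n^e; with absolute constants the claim fails: for n=2, m=1, r→∞, rewriting all memory at each operation costs only O(r/w). Priorities/keys are distinct, from a universe of size ≥ n, separate from the r bits. *)

(* Defs.v *)
From HB Require Import structures.
From mathcomp Require Import all_boot all_order all_algebra.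
From mathcomp Require Import reals exp.

Set Implicit Arguments.
Unset Strict Implicit.
Unset Printing Implicit Defensive.

Import Order.TTheory GRing.Theory Num.Theory.

(** * Data structure problems *)

(* [step s o] is [None] when [o] is not permitted in state [s]; otherwise it
   gives the next state and, if [o] is a query, the correct answer. *)
Record problem := Problem {
  op : finType;
  ans : eqType;
  state : Type;
  init : state;
  step : state -> op -> option (state * option ans)
}.

Fixpoint correct_from (P : problem) (s : state P) (y : seq (op P)) :
    option (seq (option (ans P))) :=
  if y isn't o :: y' then Some [::] else
  if step s o is Some (s', a) then omap (cons a) (correct_from s' y') else None.

(* [Some l], with one entry of [l] per operation, when all operations of [y]
   are permitted. *)
Definition correct_answers (P : problem) (y : seq (op P)) :=
  correct_from (init P) y.

Definition valid (P : problem) (y : seq (op P)) : bool := isSome (correct_answers y).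

Definition elt (r : nat) := r.-tuple bool.

(* In the five problems below an insertion is permitted only if fewer than [n]
   elements are stored, and a removal only if the element to be removed exists. *)

(** ** Stack *)

Inductive stack_op (r : nat) := Push of elt r | Pop.
Arguments Pop {r}.

Section StackOp.
Variable r : nat.
Definition stack_op_code (o : stack_op r) : option (elt r) :=
  if o is Push x then Some x else None.
Definition stack_op_decode (c : option (elt r)) : stack_op r :=
  if c is Some x then Push x else Pop.
Lemma stack_op_codeK : cancel stack_op_code stack_op_decode.
Proof. by case. Qed.
HB.instance Definition _ := Finite.copy (stack_op r) (can_type stack_op_codeK).
End StackOp.

Definition stack_step n r (s : seq (elt r)) (o : stack_op r) :
    option (seq (elt r) * option (elt r)) :=
  match o with
  | Push x => if size s < n then Some (x :: s, None) else None
  | Pop => if s is x :: s' then Some (s', Some x) else None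
  end.

Definition stack n r : problem := Problem [::] (@stack_step n r).

(** ** Queue *)

Inductive queue_op (r : nat) := Enqueue of elt r | Dequeue.
Arguments Dequeue {r}.

Section QueueOp.
Variable r : nat.
Definition queue_op_code (o : queue_op r) : option (elt r) :=
  if o is Enqueue x then Some x else None.
Definition queue_op_decode (c : option (elt r)) : queue_op r :=
  if c is Some x then Enqueue x else Dequeue.
Lemma queue_op_codeK : cancel queue_op_code queue_op_decode.
Proof. by case. Qed.
HB.instance Definition _ := Finite.copy (queue_op r) (can_type queue_op_codeK).
End QueueOp.

Definition queue_step n r (s : seq (elt r)) (o : queue_op r) :
    option (seq (elt r) * option (elt r)) :=
  match o with
  | Enqueue x => if size s < n then Some (rcons s x, None) else None
  | Dequeue => if s is x :: s' then Some (s', Some x) else None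
  end.

Definition queue n r : problem := Problem [::] (@queue_step n r).

(** ** Deque *)

Inductive deque_op (r : nat) :=
  PushFront of elt r | PushBack of elt r | PopFront | PopBack.
Arguments PopFront {r}.
Arguments PopBack {r}.

Section DequeOp.
Variable r : nat.
Definition deque_op_code (o : deque_op r) : bool * option (elt r) :=
  match o with
  | PushFront x => (true, Some x)
  | PushBack x => (false, Some x)
  | PopFront => (true, None)
  | PopBack => (false, None)
  end.
Definition deque_op_decode (c : bool * option (elt r)) : deque_op r :=
  match c with
  | (true, Some x) => PushFront x
  | (false, Some x) => PushBack x
  | (true, None) => PopFront
  | (false, None) => PopBack
  end.
Lemma deque_op_codeK : cancel deque_op_code deque_op_decode.
Proof. by case. Qed.
HB.instance Definition _ := Finite.copy (deque_op r) (can_type deque_op_codeK).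
End DequeOp.

Definition deque_step n r (s : seq (elt r)) (o : deque_op r) :
    option (seq (elt r) * option (elt r)) :=
  match o with
  | PushFront x => if size s < n then Some (x :: s, None) else None
  | PushBack x => if size s < n then Some (rcons s x, None) else None
  | PopFront => if s is x :: s' then Some (s', Some x) else None
  | PopBack => if s is x :: s' then Some (belast x s', Some (last x s')) else None
  end.

Definition deque n r : problem := Problem [::] (@deque_step n r).

(** ** Priority queue and search tree *)

(* Priorities, respectively search keys, come from ['I_u]; an element carries
   [r] bits besides its priority or key.  An insertion is permitted only if no
   stored element has the same priority or key, so that "the element of minimum
   priority" is unambiguous. *)
Definition dict (u r : nat) := {ffun 'I_u -> option (elt r)}.

(* In increasing order. *)
Definition keys u r (s : dict u r) : seq 'I_u := [seq k <- enum 'I_u | isSome (s k)].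

Definition update u r (s : dict u r) (k : 'I_u) (x : option (elt r)) : dict u r :=
  [ffun j => if j == k then x else s j].

Definition insert n u r (s : dict u r) (k : 'I_u) (x : elt r) : option (dict u r) :=
  if (size (keys s) < n) && (s k == None) then Some (update s k (Some x)) else None.

Inductive pq_op (u r : nat) := PQInsert of 'I_u & elt r | ExtractMin.
Arguments ExtractMin {u r}.

Section PQOp.
Variables u r : nat.
Definition pq_op_code (o : pq_op u r) : option ('I_u * elt r) :=
  if o is PQInsert p x then Some (p, x) else None.
Definition pq_op_decode (c : option ('I_u * elt r)) : pq_op u r :=
  if c is Some (p, x) then PQInsert p x else ExtractMin.
Lemma pq_op_codeK : cancel pq_op_code pq_op_decode.
Proof. by case. Qed.
HB.instance Definition _ := Finite.copy (pq_op u r) (can_type pq_op_codeK).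
End PQOp.

Definition pq_step n u r (s : dict u r) (o : pq_op u r) :
    option (dict u r * option (elt r)) :=
  match o with
  | PQInsert p x => omap (fun s' => (s', None)) (insert n s p x)
  | ExtractMin => omap (fun p => (update s p None, s p)) (ohead (keys s))
  end.

Definition priority_queue n u r : problem :=
  Problem [ffun=> None] (@pq_step n u r).

Inductive tree_op (u r : nat) :=
  Insert of 'I_u & elt r | Delete of 'I_u | Predecessor of 'I_u | Successor of 'I_u.
Arguments Delete {u r}.
Arguments Predecessor {u r}.
Arguments Successor {u r}.

Section TreeOp.
Variables u r : nat.
Definition tree_op_code (o : tree_op u r) : 'I_u * elt r + 'I_u + ('I_u + 'I_u) :=
  match o with
  | Insert k x => inl (inl (k, x))
  | Delete k => inl (inr k)
  | Predecessor k => inr (inl k)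
  | Successor k => inr (inr k)
  end.
Definition tree_op_decode (c : 'I_u * elt r + 'I_u + ('I_u + 'I_u)) : tree_op u r :=
  match c with
  | inl (inl (k, x)) => Insert k x
  | inl (inr k) => Delete k
  | inr (inl k) => Predecessor k
  | inr (inr k) => Successor k
  end.
Lemma tree_op_codeK : cancel tree_op_code tree_op_decode.
Proof. by case. Qed.
HB.instance Definition _ := Finite.copy (tree_op u r) (can_type tree_op_codeK).
End TreeOp.

Definition lookup u r (s : dict u r) (k : 'I_u) : option ('I_u * elt r) :=
  omap (pair k) (s k).

(* [Predecessor k] asks for the stored element with the largest key [<= k],
   [Successor k] for the one with the smallest key [>= k]; the correct answer is
   [None] if there is none. *)
Definition tree_step n u r (s : dict u r) (o : tree_op u r) :
    option (dict u r * option (option ('I_u * elt r))) :=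
  match o with
  | Insert k x => omap (fun s' => (s', None)) (insert n s k x)
  | Delete k => if s k is Some _ then Some (update s k None, None) else None
  | Predecessor k =>
      Some (s, Some (obind (lookup s) (ohead (rev [seq j : 'I_u <- keys s | (j <= k)%N]))))
  | Successor k =>
      Some (s, Some (obind (lookup s) (ohead [seq j : 'I_u <- keys s | (k <= j)%N])))
  end.

Definition search_tree n u r : problem :=
  Problem [ffun=> None] (@tree_step n u r).

Inductive ds_kind := Stack | Queue | Deque | PriorityQueue | SearchTree.

(* [u] is only used by the problems with priorities or keys. *)
Definition problem_of (k : ds_kind) (n u r : nat) : problem :=
  match k with
  | Stack => stack n r
  | Queue => queue n r
  | Deque => deque n r
  | PriorityQueue => priority_queue n u r
  | SearchTree => search_tree n u r
  end.

(** * The oblivious cell probe model *)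

Definition cell (w : nat) := w.-tuple bool.
Definition client (m : nat) := m.-tuple bool.

(* The processing of one operation, as a decision tree.  A probe reads the cell
   at address [a]; a cell with contents [v] is overwritten with [f v] (which may
   be [v]), and processing goes on according to [v].  Processing ends with new
   client memory contents and an announced answer, which is ignored for
   operations that are not queries. *)
Inductive probing (K w m : nat) (A : Type) :=
  | Done of client m & option A
  | Probe (a : 'I_K) (f : cell w -> cell w) (k : cell w -> probing K w m A).

(* [coins] is the length of the random bit string; it is not bounded in terms of
   the other parameters. *)
Record data_structure (P : problem) (w m : nat) := DataStructure {
  cells : nat;
  cells_le : cells <= 2 ^ w;
  coins : nat;
  client0 : client m;
  server0 : {ffun 'I_cells -> cell w};
  process : op P -> client m -> coins.-tuple bool -> probing cells w m (ans P)
}.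
Arguments process {P w m} d.

Fixpoint run (K w m : nat) (A : Type) (t : probing K w m A)
    (mem : {ffun 'I_K -> cell w}) :
    seq 'I_K * {ffun 'I_K -> cell w} * client m * option A :=
  match t with
  | Done c a => ([::], mem, c, a)
  | Probe a f k =>
      let: (l, mem', c, b) :=
        run (k (mem a)) [ffun j => if j == a then f (mem a) else mem j] in
      (a :: l, mem', c, b)
  end.

Section Model.
Variables (P : problem) (w m : nat) (D : data_structure P w m).

Fixpoint execute (rho : (coins D).-tuple bool) (mem : {ffun 'I_(cells D) -> cell w})
    (c : client m) (y : seq (op P)) : seq (seq 'I_(cells D) * option (ans P)) :=
  if y isn't o :: y' then [::] else
  let: (l, mem', c', a) := run (process D o c rho) mem in
  (l, a) :: execute rho mem' c' y'.

Definition probes (y : seq (op P)) (rho : (coins D).-tuple bool) :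
    seq (seq 'I_(cells D)) :=
  unzip1 (execute rho (server0 D) (client0 D) y).

Definition answers (y : seq (op P)) (rho : (coins D).-tuple bool) :
    seq (option (ans P)) :=
  unzip2 (execute rho (server0 D) (client0 D) y).

End Model.
Arguments probes {P w m} D.
Arguments answers {P w m} D.

(** * Polynomial-time distinguishers *)

(* Random access machines with unit cost, whose arithmetic is addition and
   truncated subtraction.  The input is a read-only array. *)
Inductive instr :=
  | IConst (i c : nat)      (* r_i := c *)
  | IAdd (i j k : nat)      (* r_i := r_j + r_k *)
  | ISub (i j k : nat)      (* r_i := r_j - r_k *)
  | ILoad (i j : nat)       (* r_i := r_(r_j) *)
  | IStore (i j : nat)      (* r_(r_i) := r_j *)
  | IInput (i j : nat)      (* r_i := input[r_j] *)
  | IJz (i l : nat).        (* if r_i = 0 then go to instruction l *)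

Definition program := seq instr.

Definition nbits (c : nat) : nat := (trunc_log 2 c).+1.

Definition instr_size (i : instr) : nat :=
  match i with
  | IAdd i j k | ISub i j k => (nbits i + nbits j + nbits k).+1
  | IConst i j | ILoad i j | IStore i j | IInput i j | IJz i j => (nbits i + nbits j).+1
  end.

Definition program_size (p : program) : nat := \sum_(i <- p) instr_size i.

Definition set_reg (g : nat -> nat) (i v : nat) : nat -> nat :=
  fun j => if j == i then v else g j.

(* The machine halts when the program counter leaves the program. *)
Definition ram_step (p : program) (input : seq nat) (s : nat * (nat -> nat)) :
    nat * (nat -> nat) :=
  let: (pc, g) := s in
  match onth p pc with
  | None => s
  | Some (IConst i c) => (pc.+1, set_reg g i c)
  | Some (IAdd i j k) => (pc.+1, set_reg g i (g j + g k))
  | Some (ISub i j k) => (pc.+1, set_reg g i (g j - g k))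
  | Some (ILoad i j) => (pc.+1, set_reg g i (g (g j)))
  | Some (IStore i j) => (pc.+1, set_reg g (g i) (g j))
  | Some (IInput i j) => (pc.+1, set_reg g i (nth 0 input (g j)))
  | Some (IJz i l) => (if g i == 0 then l else pc.+1, g)
  end.

Definition ram_run (p : program) (input : seq nat) (t : nat) : nat * (nat -> nat) :=
  iter t (ram_step p input) (0, fun=> 0).

(* Address [a] is written as [a + 2], and the list of probes of each operation is
   terminated by [1]; a machine reads [0] beyond the end. *)
Definition encode (K : nat) (x : seq (seq 'I_K)) : seq nat :=
  flatten [seq rcons [seq a.+2 | a : 'I_K <- l] 1 | l : seq 'I_K <- x].

(* [f] is computed, on the probe sequences of [M] operations, within [t] steps by
   a program of size at most [t].  The program may depend on [M] and on the data
   structure; charging for its size, including the constants in it, prevents it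
   from containing large precomputed tables. *)
Definition computable_within (t K M : nat) (f : seq (seq 'I_K) -> bool) : Prop :=
  exists2 p : program, program_size p <= t &
    forall x, size x = M ->
      let: (pc, g) := ram_run p (encode x) t in
      size p <= pc /\ (g 0 != 0) = f x.

Local Open Scope ring_scope.

(** * Correctness, security and cost *)

Section Measures.
Variables (R : realType) (P : problem) (w m : nat) (D : data_structure P w m).

Definition Pr (E : pred ((coins D).-tuple bool)) : R :=
  #|E|%:R / #|{: (coins D).-tuple bool}|%:R.

Definition failure_probability_le (delta : R) : Prop :=
  forall (y : seq (op P)) (l : seq (option (ans P))),
    correct_answers y = Some l ->
    forall (i : nat) (a : ans P), nth None l i = Some a ->
      1 - delta <= Pr (fun rho => nth None (answers D y rho) i == Some a).

(* Every polynomial in the three parameters is at most [(M + w + lg |op| + 2) ^ d]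
   for some [d]. *)
Definition time_bound (d M : nat) : nat := ((M + w + up_log 2 #|op P|) + 2) ^ d.

(* Security against the distinguishers running in time [time_bound d]; for fixed
   [d] this is weaker than security against all polynomial-time distinguishers. *)
Definition secure (d : nat) : Prop :=
  forall (M : nat) (y z : seq (op P)),
    valid y -> valid z -> size y = M -> size z = M ->
    forall f : seq (seq 'I_(cells D)) -> bool,
      computable_within (time_bound d M) M f ->
      `| Pr (fun rho => f (probes D y rho)) - Pr (fun rho => f (probes D z rho)) |
        <= 1 / 4.

Definition expected_amortized_time (y : seq (op P)) : R :=
  (\sum_(rho : (coins D).-tuple bool) (sumn (map size (probes D y rho)))%:R)
    / #|{: (coins D).-tuple bool}|%:R / (size y)%:R.

End Measures.

Definition lg (R : realType) (x : R) : R := ln x / ln 2.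

(* Main.v *)
Require Import Defs.
From Stdlib Require ZArith.
From HB Require Import structures.
From mathcomp Require Import all_boot all_order all_algebra.
From mathcomp Require Import reals exp.
From mathcomp Require Import zify ring lra.

(** An information transfer argument. For adjacent blocks of [k] operations, call a
    cell shared if it is probed in both. If the first block stores [k] random elements
    and the second one retrieves them, then the coins, the client memory between the
    blocks and the addresses and contents of the shared cells determine the answers of
    the second block. An encoding argument that tolerates an error rate of 7/15 then
    shows that with probability above 121/448 > 1/4 there are at least [r k / (3780 w)]
    shared cells, provided that [r k >= 3780 m]. Whether there are that many is decided
    by scanning the probe sequence once, so by security the same holds with
    probability at least 1/100 for every pair of blocks on every sequence of length
    [n]. In a binary tree over the operations, each probe is charged to at most one
    node, so the numbers of shared cells of all the nodes add up to at most the running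
    time; each of the [Omega(lg (n r / m))] levels with large enough blocks contributes
    [Omega(n r / w)]. *)

Set Implicit Arguments.
Unset Strict Implicit.
Unset Printing Implicit Defensive.

Import Order.TTheory GRing.Theory Num.Theory.

(** * Counting inputs with few mismatches *)

Lemma leq_expn2r (m n e : nat) : m <= n -> m ^ e <= n ^ e.
Proof. by case: e => [|e] le_mn //; rewrite leq_exp2r. Qed.

Definition mismatches {k : nat} {E : Type} {A : eqType} (g : 'I_k -> E -> A)
    (v : 'I_k -> option A) (x : {ffun 'I_k -> E}) : nat :=
  #|[pred j | v j != Some (g j (x j))]|.

(** Weight each coordinate of [x] by [a] if it matches [v] and by [b] otherwise. Inputs with at most
    [h] mismatches have weight at least [a ^ (k - h) * b ^ h]. The total weight factors over the
    coordinates, and by injectivity at most one value matches in each. *)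
Lemma weighted_mismatches (k : nat) (E : finType) (A : eqType)
    (g : 'I_k -> E -> A) (v : 'I_k -> option A) (a b h : nat) :
  (forall j, injective (g j)) -> b <= a -> h <= k ->
  #|[pred x | mismatches g v x <= h]| * (a ^ (k - h) * b ^ h)
    <= (a + #|E|.-1 * b) ^ k.
Proof.
move=> inj_g le_ba le_hk.
pose c j e := if v j == Some (g j e) then a else b.
have weight (x : {ffun _ -> _}) : \prod_j c j (x j) =
    a ^ (k - mismatches g v x) * b ^ mismatches g v x.
  rewrite (bigID (fun j => v j == Some (g j (x j)))) /=; congr (_ * _).
    rewrite (eq_bigr (fun=> a)); last by move=> j; rewrite /c => ->.
    rewrite prod_nat_const; congr (_ ^ _).
    rewrite -[k in k - _]card_ord -(cardC [pred j | v j == Some (g j (x j))]).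
    by rewrite addnK.
  rewrite (eq_bigr (fun=> b)); last by move=> j; rewrite /c => /negbTE ->.
  by rewrite prod_nat_const.
have column j : \sum_e c j e <= a + #|E|.-1 * b.
  case: (pickP [pred e | v j == Some (g j e)]) => [e0 /= /eqP v_e0 | none].
    rewrite (bigD1 e0) //= {1}/c v_e0 eqxx leq_add2l.
    rewrite (eq_bigr (fun=> b)) ?sum_nat_const ?cardC1 //.
    move=> e ne_e; rewrite /c v_e0; case: ifP => // /eqP [] /inj_g eq_e.
    by rewrite eq_e eqxx in ne_e.
  rewrite (eq_bigr (fun=> b)) => [|e _]; last by rewrite /c; move: (none e) => /= ->.
  by rewrite sum_nat_const; case: #|E| => [|q] //=; rewrite mulSn leq_add2r.
apply: (@leq_trans (\sum_(x : {ffun 'I_k -> E}) \prod_j c j (x j))).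
  rewrite -sum_nat_const big_mkcond /=; apply: leq_sum => x _.
  rewrite inE weight; case: ifP => // le_mh.
  have -> : b ^ h = b ^ (h - mismatches g v x) * b ^ mismatches g v x.
    by rewrite -expnD subnK.
  rewrite mulnA leq_mul2r; apply/orP; right.
  have -> : k - mismatches g v x = (k - h) + (h - mismatches g v x) by lia.
  by rewrite expnD leq_mul2l leq_expn2r ?orbT.
rewrite -(bigA_distr_bigA c) -[k in _ ^ k]card_ord -prod_nat_const.
exact: leq_prod.
Qed.

(** Transfers the next inequality to binary integers, where it can be evaluated. *)
Lemma Z_of_expn (m n : nat) :
  BinInt.Z.of_nat (m ^ n) = BinInt.Z.pow (BinInt.Z.of_nat m) (BinInt.Z.of_nat n).
Proof.
elim: n => [|n IH] //; rewrite expnS Znat.Nat2Z.inj_mul IH Znat.Nat2Z.inj_succ.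
by rewrite BinInt.Z.pow_succ_r //; exact: Zorder.Zle_0_nat.
Qed.

(* The binary entropy of 7/15 is at most [1 - 1/315]. The bases are variables to keep
   unary numbers of this size from being computed. *)
Lemma entropy_bound (a b s t : nat) :
  a = 8 -> b = 7 -> s = 15 -> t = 2 ->
  s ^ 315 * t <= (a ^ 8 * b ^ 7) ^ 21 * t ^ 315.
Proof.
move=> aE bE sE tE; apply/ssrnat.leP/Znat.Nat2Z.inj_le.
rewrite !(Znat.Nat2Z.inj_mul, Z_of_expn) aE bE sE tE.
by apply/BinInt.Z.leb_le; vm_compute.
Qed.

(* For [r = 1] the optimal weights at error rate 7/15 are 8 and 7. *)
Lemma few_mismatches (k r : nat) (A : eqType) (g : 'I_k -> elt r -> A)
    (v : 'I_k -> option A) :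
  (forall j, injective (g j)) -> 0 < r ->
  #|[pred x | 15 * mismatches g v x <= 7 * k]| ^ 315 * 2 ^ (r * k)
    <= 2 ^ (315 * (r * k)).
Proof.
move=> inj_g r_gt0; set Z := #|_|; set h := 7 * k %/ 15.
have le_h : h * 15 <= 7 * k by apply: leq_trunc_div.
have le_hk : h <= k by lia.
(* The 15th power turns the exponents [k - h] and [h] into [8 * k] and [7 * k]; the rounding in [h]
   costs nothing since [b <= a]. *)
have bound a b : 0 < b -> b <= a ->
    Z ^ 15 * (a ^ 8 * b ^ 7) ^ k <= (a + (2 ^ r).-1 * b) ^ (15 * k).
  move=> b_gt0 le_ba.
  have := weighted_mismatches v inj_g le_ba le_hk.
  rewrite card_tuple card_bool => W.
  have {W} : (Z * (a ^ (k - h) * b ^ h)) ^ 15 <= (a + (2 ^ r).-1 * b) ^ (15 * k).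
    rewrite [15 * k]mulnC expnM leq_exp2r //.
    apply: leq_trans W; rewrite leq_mul2r; apply/orP; right.
    by apply/eq_leq/eq_card => x; rewrite !inE /h leq_divRL // mulnC.
  move=> W; apply: leq_trans W; rewrite [leqRHS]expnMn leq_mul2l; apply/orP; right.
  rewrite [leqLHS]expnMn [leqRHS]expnMn -!expnM.
  have -> : 7 * k = (7 * k - h * 15) + h * 15 by rewrite subnK.
  rewrite expnD mulnA leq_mul2r; apply/orP; right.
  have -> : (k - h) * 15 = 8 * k + (7 * k - h * 15) by lia.
  by rewrite expnD leq_mul2l leq_expn2r ?orbT.
case: r => [//|[|r]] in g inj_g r_gt0 Z bound *.
  have [a aE] : exists a, a = 8 by exists 8.
  have [b bE] : exists b, b = 7 by exists 7.
  have [s sE] : exists s, s = 15 by exists 15.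
  have [t tE] : exists t, t = 2 by exists 2.
  have num := entropy_bound aE bE sE tE.
  have {bound} : Z ^ 15 * (a ^ 8 * b ^ 7) ^ k <= s ^ (15 * k).
    have sE' : s = a + (2 ^ 1).-1 * b by rewrite aE bE sE.
    have b_gt0 : 0 < b by rewrite bE.
    have le_ba : b <= a by rewrite aE bE.
    rewrite sE'; exact: bound.
  set c := _ * _ ^ 7 in num *; have c_gt0 : 0 < c.
    by rewrite muln_gt0 !expn_gt0 aE bE.
  move=> bound; suff : Z ^ 315 * t ^ k <= t ^ (315 * k) by rewrite tE mul1n.
  have {bound} : Z ^ 315 * (c ^ 21) ^ k <= (s ^ 315) ^ k.
    have : (Z ^ 15 * c ^ k) ^ 21 <= (s ^ (15 * k)) ^ 21.
      exact: leq_expn2r.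
    rewrite expnMn -!expnM (_ : 15 * 21 = 315) // [k * 21]mulnC.
    by rewrite (_ : 15 * k * 21 = 315 * k) //; lia.
  move=> bound; rewrite -(@leq_pmul2r ((c ^ 21) ^ k)) ?expn_gt0 ?c_gt0 //.
  rewrite expnM -expnMn [t ^ _ * c ^ _]mulnC.
  apply: leq_trans (leq_expn2r _ num); rewrite expnMn mulnAC.
  by rewrite leq_mul2r bound orbT.
(* With at least two bits per element the cruder weights [2 ^ r.+2] and 1 suffice: a column weighs
   less than [2 ^ r.+3], and after taking 21st powers the claim reduces to [315 <= 167 * r.+2]. *)
have {bound} := bound (2 ^ r.+2) 1 isT (expn_gt0 _ _).
rewrite exp1n !muln1 => bound.
have {bound} : Z ^ 15 * 2 ^ (8 * (r.+2 * k)) <= 2 ^ (15 * (r.+2 * k + k)).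
  rewrite -!expnM in bound.
  have -> : 8 * (r.+2 * k) = r.+2 * (8 * k) by lia.
  apply: leq_trans bound _.
  have -> : 15 * (r.+2 * k + k) = r.+3 * (15 * k) by lia.
  rewrite [leqRHS]expnM leq_expn2r // [2 ^ r.+3]expnS mul2n -addnn.
  by rewrite leq_add2l leq_pred.
move=> bound.
have {bound} : (Z ^ 15 * 2 ^ (8 * (r.+2 * k))) ^ 21 <= (2 ^ (15 * (r.+2 * k + k))) ^ 21.
  exact: leq_expn2r.
rewrite expnMn -!expnM (_ : 15 * 21 = 315) // => bound.
rewrite -(@leq_pmul2r (2 ^ (8 * (r.+2 * k) * 21))) ?expn_gt0 // mulnAC.
apply: (@leq_trans (2 ^ (15 * (r.+2 * k + k) * 21) * 2 ^ (r.+2 * k))).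
  by rewrite leq_mul2r bound orbT.
rewrite -!expnD leq_exp2l //.
have : 2 * k <= r.+2 * k by rewrite leq_mul2r; lia.
lia.
Qed.

(** * Decoding from the shared cells *)

Section Locality.

Variables (K w m : nat) (A : Type).
Implicit Types (t : probing K w m A) (mem : {ffun 'I_K -> cell w}).

(** Processing sees the memory only through the cells it probes, and writes the same values into
    them. The second conclusion carries the agreement on to the next operation. *)
Lemma run_agree t mem1 mem2 l mem1' c a :
  run t mem1 = (l, mem1', c, a) -> {in l, mem1 =1 mem2} ->
  exists2 mem2', run t mem2 = (l, mem2', c, a) &
    forall b, mem1 b = mem2 b -> mem1' b = mem2' b.
Proof.
elim: t => [c0 a0|b0 f k IH] in mem1 mem2 l mem1' c a *.
  by case=> <- <- <- <- _; exists mem2.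
rewrite /=; case E: run => [[[l' memE] c'] a'] [<- <- <- <-] agree.
have eq_b0 : mem1 b0 = mem2 b0 by apply: agree; rewrite mem_head.
set mem2b := [ffun j => if j == b0 then f (mem2 b0) else mem2 j].
have [|mem2' run2 agree'] := IH _ _ mem2b _ _ _ _ E.
  move=> b b_l; rewrite !ffunE eq_b0; case: eqP => // _.
  by apply: agree; rewrite inE b_l orbT.
exists mem2'; first by rewrite -eq_b0 run2.
by move=> b eq_b; apply: agree'; rewrite !ffunE eq_b0 eq_b.
Qed.

Lemma run_untouched t mem l mem' c a b :
  run t mem = (l, mem', c, a) -> b \notin l -> mem' b = mem b.
Proof.
elim: t => [c0 a0|b0 f k IH] in mem l mem' c a *; first by case=> _ <-.
rewrite /=; case E: run => [[[l' memE] c'] a'] [<- <- _ _].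
rewrite inE negb_or => /andP[/negbTE ne_b /(IH _ _ _ _ _ _ E) ->].
by rewrite ffunE ne_b.
Qed.

End Locality.

Section Execution.

Variables (P : problem) (w m : nat) (D : data_structure P w m).
Variable rho : (coins D).-tuple bool.

Notation memory := {ffun 'I_(cells D) -> cell w}.
Implicit Types (mem : memory) (c : client m) (y : seq (op P)).

Fixpoint state_after mem c y : memory * client m :=
  if y isn't o :: y' then (mem, c) else
  let: (_, mem', c', _) := run (process D o c rho) mem in state_after mem' c' y'.

Lemma execute_cat mem c y1 y2 :
  execute rho mem c (y1 ++ y2) = execute rho mem c y1 ++
    execute rho (state_after mem c y1).1 (state_after mem c y1).2 y2.
Proof.
elim: y1 => [|o y1 IH] //= in mem c *.
by case: run => [[[l mem'] c'] a] /=; rewrite IH.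
Qed.

Lemma size_execute mem c y : size (execute rho mem c y) = size y.
Proof.
elim: y => [|o y IH] //= in mem c *.
by case: run => [[[l mem'] c'] a] /=; rewrite IH.
Qed.

Definition touched mem c y : seq 'I_(cells D) :=
  flatten (unzip1 (execute rho mem c y)).

Lemma state_after_untouched mem c y b :
  b \notin touched mem c y -> (state_after mem c y).1 b = mem b.
Proof.
rewrite /touched; elim: y => [|o y IH] //= in mem c *.
case E: run => [[[l mem'] c'] a] /=; rewrite mem_cat negb_or => /andP[b_l b_y].
by rewrite IH // (run_untouched E b_l).
Qed.

Lemma execute_agree mem1 mem2 c y :
  {in touched mem1 c y, mem1 =1 mem2} ->
  execute rho mem1 c y = execute rho mem2 c y.
Proof.
rewrite /touched; elim: y => [|o y IH] //= in mem1 mem2 c *.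
case E: run => [[[l mem1'] c'] a] /= agree.
have [|mem2' -> agree'] := run_agree E (mem2 := mem2).
  by move=> b b_l; apply: agree; rewrite mem_cat b_l.
by rewrite (IH _ mem2') // => b b_y; apply/agree'/agree; rewrite mem_cat b_y orbT.
Qed.

(* [None] pads patches of fewer than [T] cells. *)
Definition patch (T : nat) (pt : T.-tuple (option ('I_(cells D) * cell w))) mem :=
  foldr (fun e mem => if e is Some (a, v) then [ffun j => if j == a then v else mem j]
                      else mem) mem pt : memory.

(** The cells of [S] are listed with their contents in [mem']. Padding to length exactly [T] makes
    all patches members of one finite type, whose size can be counted. *)
Lemma patchP (T : nat) (S : pred 'I_(cells D)) mem mem' :
  #|S| <= T -> exists pt : T.-tuple _,
    forall b, patch pt mem b = if S b then mem' b else mem b.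
Proof.
move=> le_ST.
pose s := [seq Some (a, mem' a) | a <- enum S] ++ nseq (T - #|S|) None.
have /eqP size_s : size s = T.
  by rewrite size_cat size_map size_nseq -cardE subnKC.
exists (Tuple size_s) => b; rewrite /patch /= foldr_cat.
have -> : forall i, foldr (fun (e : option ('I_(cells D) * cell w)) (mem : memory) =>
    if e is Some (a, v) then [ffun j => if j == a then v else mem j] else mem)
    mem (nseq i None) = mem by elim.
rewrite -[S b]mem_enum; elim: (enum S) => //= a s' IH.
by rewrite ffunE inE; case: eqP => [->|].
Qed.

(* In the second part only the cells also touched in the first one can differ from
   their contents before the first part. *)
Lemma answers_from_patch (T : nat) mem c y1 y2 :
  let: (mem', c') := state_after mem c y1 in
  #|[pred b | (b \in touched mem c y1) && (b \in touched mem' c' y2)]| <= T ->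
  exists pt : T.-tuple _,
    execute rho mem' c' y2 = execute rho (patch pt mem) c' y2.
Proof.
case E: state_after => [mem' c'] le_T.
have [pt patchE] := patchP mem mem' le_T.
exists pt; apply: execute_agree => b b_2; rewrite patchE /= b_2 andbT.
case: ifP => // /negbT b_1.
by have := state_after_untouched b_1; rewrite E.
Qed.

End Execution.

(** * A machine counting shared cells *)

Section StraightLine.

(** A separate name keeps input lookups folded when [nth] is unfolded to evaluate lists of register
    values. *)
Definition symbol (input : seq nat) (p : nat) : nat := nth 0 input p.

Definition effect (input : seq nat) (g : nat -> nat) (i : instr) : nat -> nat :=
  match i with
  | IConst i c => set_reg g i c
  | IAdd i j k => set_reg g i (g j + g k)
  | ISub i j k => set_reg g i (g j - g k)
  | ILoad i j => set_reg g i (g (g j))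
  | IStore i j => set_reg g (g i) (g j)
  | IInput i j => set_reg g i (symbol input (g j))
  | IJz _ _ => g
  end.

Definition no_jump (i : instr) : bool := if i is IJz _ _ then false else true.

(** Without jumps the program counter equals the number of steps made. The distinguisher is fully
    unrolled, so no reasoning about control flow is needed. *)
Lemma ram_run_straight_line (p : program) (input : seq nat) (t : nat) :
  all no_jump p -> size p <= t ->
  ram_run p input t = (size p, foldl (effect input) (fun=> 0) p).
Proof.
move=> nj le_pt.
have run_prefix t' : t' <= size p -> ram_run p input t' =
    (t', foldl (effect input) (fun=> 0) (take t' p)).
  elim: t' => [_|t' IH lt_t]; first by rewrite take0.
  rewrite /ram_run iterS -/(ram_run p input t') IH 1?ltnW //=.
  rewrite onthE (nth_map (IConst 0 0)) // (take_nth (IConst 0 0)) // -cats1 foldl_cat /=.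
  have := all_nthP (IConst 0 0) nj _ lt_t.
  by case: (nth _ p t').
rewrite /ram_run -(subnK le_pt) iterD -/(ram_run p input (size p)).
rewrite run_prefix // take_size; elim: (t - size p) => //= k ->.
by rewrite /ram_step (onth_default (leqnn _)).
Qed.

End StraightLine.

Section Distinguisher.

Definition probed_at {K : nat} (X : seq (seq 'I_K)) (i k : nat) : seq 'I_K :=
  flatten (take k (drop i X)).

Definition shared {K : nat} (i k : nat) (X : seq (seq 'I_K)) : nat :=
  #|[pred a | (a \in probed_at X i k) && (a \in probed_at X (i + k) k)]|.

(* Registers: 0 output, 1 current symbol [s], 2 position in the input, 3 number of
   operations read, 4 number of shared cells found, 5 the constant 1, 6 the constant
   20, 7 the address [20 + s], 8 the mark, 9 [s >= 2], 10 [s = 1], 11 and 12 whether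
   the current operation is in the first and the second block, 13 scratch, 14-16 the
   borders of the blocks, 17 [T].  Register [20 + s] is marked when the cell with code
   [s] has been probed in the first block but not yet in the second one. *)
Definition scan_step : program := [::
  IInput 1 2; IAdd 2 2 5;
  ISub 13 1 5; ISub 13 5 13; ISub 9 5 13;
  ISub 10 5 1; ISub 10 5 10; ISub 10 10 9;
  ISub 11 14 3; ISub 11 5 11; ISub 12 15 3; ISub 12 5 12;
  ISub 13 16 3; ISub 13 5 13; ISub 11 11 12; ISub 12 12 13;
  IAdd 7 1 6; ILoad 8 7;
  IAdd 13 12 8; IAdd 13 13 9; ISub 13 13 5; ISub 13 13 5; IAdd 4 4 13;
  ISub 8 8 12; IAdd 8 8 11; ISub 13 5 8; ISub 8 5 13; IStore 7 8;
  IAdd 3 3 10].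

Definition scan (input : seq nat) (g : nat -> nat) : nat -> nat :=
  foldl (effect input) g scan_step.

Definition scan_init (i k T : nat) : program := [::
  IConst 5 1; IConst 6 20; IConst 14 i; IConst 15 (i + k); IConst 16 (i + k + k);
  IConst 17 T].

(** The next unread symbol is added to the excess of the count over [T]: it is nonzero exactly when
    the input has not been exhausted, so that overlong inputs are accepted. *)
Definition scan_output : program := [:: ISub 0 4 17; IInput 1 2; IAdd 0 0 1].

Definition distinguisher (i k T N : nat) : program :=
  scan_init i k T ++ flatten (nseq N scan_step) ++ scan_output.

Lemma scan_iter (input : seq nat) (g : nat -> nat) (N : nat) :
  foldl (effect input) g (flatten (nseq N scan_step)) = iter N (scan input) g.
Proof. by elim: N => [//|N IH] in g *; rewrite iterSr -IH -foldl_cat. Qed.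

Variables (i k T : nat) (input : seq nat).

(* Position, operations read, shared cells found, marks by symbol. *)
Definition scan_inv (g : nat -> nat) (p o c : nat) (mark : nat -> bool) : Prop :=
  [/\ [/\ g 2 = p, g 3 = o & g 4 = c],
      [/\ g 5 = 1, g 6 = 20 & g 17 = T], [/\ g 14 = i, g 15 = i + k & g 16 = i + k + k] &
      forall s, g (s + 20) = mark s].

Definition first_block (o : nat) := i <= o < i + k.
Definition second_block (o : nat) := i + k <= o < i + k + k.

(** A list models the registers below 20, so that instructions with fixed addresses are evaluated by
    computation. The marks, from register 20 on, are reached only through [ILoad] and [IStore]. *)
Definition low_regs (g : nat -> nat) (vals : seq nat) : Prop :=
  forall j, j < 20 -> g j = nth 0 vals j.

Definition arithmetic (ins : instr) : bool :=
  match ins with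
  | IConst a _ => a < 20
  | IAdd a b c | ISub a b c => [&& a < 20, b < 20 & c < 20]
  | IInput a b => (a < 20) && (b < 20)
  | _ => false
  end.

Definition list_effect (vals : seq nat) (ins : instr) : seq nat :=
  match ins with
  | IConst a c => set_nth 0 vals a c
  | IAdd a b c => set_nth 0 vals a (nth 0 vals b + nth 0 vals c)
  | ISub a b c => set_nth 0 vals a (nth 0 vals b - nth 0 vals c)
  | IInput a b => set_nth 0 vals a (symbol input (nth 0 vals b))
  | _ => vals
  end.

Lemma low_regs_set (g : nat -> nat) (vals : seq nat) (a v : nat) :
  low_regs g vals -> low_regs (set_reg g a v) (set_nth 0 vals a v).
Proof. by move=> gE j lt_j; rewrite /set_reg nth_set_nth /= gE. Qed.

Lemma run_arithmetic (g : nat -> nat) (vals : seq nat) (p : program) :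
  low_regs g vals -> all arithmetic p ->
  low_regs (foldl (effect input) g p) (foldl list_effect vals p) /\
  forall s, foldl (effect input) g p (s + 20) = g (s + 20).
Proof.
elim: p => [|ins p IH] //= in g vals *; move=> gE /andP[ins_ok p_ok].
have [||regsE highE] := IH (effect input g ins) (list_effect vals ins) => //.
  case: ins ins_ok => //= [a c _|a b c /and3P[_ b_ok c_ok]|a b c /and3P[_ b_ok c_ok]|a b].
  - exact: low_regs_set.
  - by rewrite (gE b) ?(gE c) //; exact: low_regs_set.
  - by rewrite (gE b) ?(gE c) //; exact: low_regs_set.
  - by case/andP=> _ b_ok; rewrite (gE b) //; exact: low_regs_set.
split=> // s; rewrite highE {highE regsE IH}.
case: ins ins_ok => //= [a c a_ok|a b c /and3P[a_ok _ _]|a b c /and3P[a_ok _ _]|a b /andP[a_ok _]];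
  by rewrite /set_reg ifN_eq //; lia.
Qed.

(** Truncated subtraction makes [1 - (a - o)] the test [a <= o]; subtracting the test [a + b <= o]
    leaves the interval. *)
Lemma between_test (a b o : nat) : 1 - (a - o) - (1 - (a + b - o)) = (a <= o < a + b).
Proof. lia. Qed.

Lemma scan_stepP (g : nat -> nat) (p o c : nat) (mark : nat -> bool) :
  scan_inv g p o c mark ->
  let s := symbol input p in
  scan_inv (scan input g) p.+1 (o + (s == 1))
    (c + [&& 1 < s, second_block o & mark s])
    (fun s' => if s' == s then first_block o || ~~ second_block o && mark s
               else mark s').
Proof.
move=> [[g2 g3 g4] [g5 g6 g17] [g14 g15 g16] gm] s.
(* The pass is cut at its two accesses to computed addresses; [p1] and [p2] are purely
   arithmetic. *)
set p1 := take 17 scan_step; set p2 := take 9 (drop 18 scan_step).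
rewrite /scan (_ : scan_step = p1 ++ ILoad 8 7 :: p2 ++ [:: IStore 7 8; IAdd 3 3 10]) //.
rewrite foldl_cat.
have g_low : low_regs g (mkseq g 20) by move=> j lt_j; rewrite nth_mkseq.
have [] := run_arithmetic (p := p1) g_low isT.
move: (foldl _ _ p1) => g1 low1 high1.
cbv [p1 scan_step take foldl list_effect set_nth nth mkseq map iota] in low1.
have addr_s : 1 - (1 - (s - 1)) = (1 < s) by lia.
have term_s : 1 - (1 - s) - (1 < s) = (s == 1) by lia.
have first_o : 1 - (i - o) - (1 - (i + k - o)) = first_block o by apply: between_test.
have second_o : 1 - (i + k - o) - (1 - (i + k + k - o)) = second_block o.
  exact: between_test.
rewrite g2 g3 g4 g5 g6 g14 g15 g16 g17 -/s addr_s term_s first_o second_o in low1.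
have g1_7 : g1 7 = s + 20 by rewrite low1.
have {low1} low2 := low_regs_set 8 (g1 (g1 7)) low1.
rewrite -[foldl _ _ (_ :: _)]/(foldl (effect input) (set_reg g1 8 (g1 (g1 7)))
  (p2 ++ [:: IStore 7 8; IAdd 3 3 10])).
have high2 s' : set_reg g1 8 (g1 (g1 7)) (s' + 20) = mark s'.
  by rewrite /set_reg ifN_eq ?high1 ?gm //; lia.
move: (set_reg g1 _ _) low2 high2; rewrite g1_7 high1 gm => g2' low2 high2.
have [] := run_arithmetic (p := p2) low2 isT.
rewrite foldl_cat; move: (foldl _ _ p2) => g3' low3 high3.
cbv [p2 scan_step take drop foldl list_effect set_nth nth] in low3.
have g3_7 : g3' 7 = s + 20 by rewrite low3.
rewrite -[foldl _ _ _]/(set_reg (set_reg g3' (g3' 7) (g3' 8)) 3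
  (set_reg g3' (g3' 7) (g3' 8) 3 + set_reg g3' (g3' 7) (g3' 8) 10)).
have low4 j : j < 20 -> set_reg g3' (g3' 7) (g3' 8) j = g3' j.
  by move=> lt_j; rewrite /set_reg g3_7 ifN_eq // neq_ltn ltn_addl.
have high4 s' : set_reg g3' (g3' 7) (g3' 8) (s' + 20) =
    if s' == s then g3' 8 : nat else mark s'.
  by rewrite /set_reg g3_7 eqn_add2r high3 high2.
move: (set_reg g3' _ _) low4 high4 => g4' low4 high4.
have keep j : j < 20 -> j != 3 -> set_reg g4' 3 (g4' 3 + g4' 10) j = g3' j.
  by move=> lt_j /negbTE ne_j; rewrite /set_reg ne_j low4.
split; [split | split | split | move=> s'].
- by rewrite keep // low3 // -[nth _ _ _]/(p + 1) addn1.
- by rewrite /set_reg eqxx !low4 // !low3.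
(* Three tests sum to more than 2 only if all hold, so subtracting 1 twice yields their
   conjunction. *)
- rewrite keep // low3 // -[nth _ _ _]/(c + (second_block o + mark s + (1 < s) - 1 - 1)).
  by case: second_block; case: (mark s); case: (1 < s).
- by rewrite keep // low3.
- by rewrite keep // low3.
- by rewrite keep // low3.
- by rewrite keep // low3.
- by rewrite keep // low3.
- by rewrite keep // low3.
rewrite /set_reg ifN_eq; last by lia.
rewrite high4; case: eqP => // _; rewrite low3 //.
rewrite -[nth _ _ _]/(1 - (1 - (mark s - second_block o + first_block o))).
by case: first_block; case: second_block; case: (mark s).
Qed.

End Distinguisher.

Opaque scan.

(** * Correctness and size of the counting program *)

Section DistinguisherSpec.

Variables (K : nat) (i k T : nat).
(** The effect of a pass reading an address, on the level of cells: [cm] pairs the count with the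
    set of marked cells. *)
Definition scan_addr (first second : bool) (cm : nat * pred 'I_K) (a : 'I_K) :
    nat * pred 'I_K :=
  (cm.1 + (second && cm.2 a),
   fun b => if b == a then first || ~~ second && cm.2 a else cm.2 b).

Fixpoint scan_ops (o : nat) (cm : nat * pred 'I_K) (x : seq (seq 'I_K)) :
    nat * pred 'I_K :=
  if x is l :: x' then 
    scan_ops o.+1 (foldl (scan_addr (first_block i k o) (second_block i k o)) cm l) x'
  else cm.

(* The marks of the symbols 0 and 1 are meaningless. *)
Definition scanning (g : nat -> nat) (p o : nat) (cm : nat * pred 'I_K) : Prop :=
  exists2 mark, scan_inv i k T g p o cm.1 mark & forall a : 'I_K, mark a.+2 = cm.2 a.

Lemma encode_cons (l : seq 'I_K) (x : seq (seq 'I_K)) :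
  encode (l :: x) = [seq a.+2 | a : 'I_K <- l] ++ 1 :: encode x.
Proof. by rewrite /encode /= cat_rcons. Qed.

Lemma scanning_addr (input : seq nat) (g : nat -> nat) (p o : nat)
    (cm : nat * pred 'I_K) (a : 'I_K) :
  symbol input p = a.+2 -> scanning g p o cm ->
  scanning (scan input g) p.+1 o (scan_addr (first_block i k o) (second_block i k o) cm a).
Proof.
move=> s_a [mark inv markE]; have := scan_stepP input inv.
rewrite s_a /= addn0 markE => inv'; eexists; first exact: inv'.
by move=> b; rewrite /= -val_eqE /= !eqSS; case: ifP.
Qed.

Lemma scanning_term (input : seq nat) (g : nat -> nat) (p o : nat)
    (cm : nat * pred 'I_K) :
  symbol input p = 1 -> scanning g p o cm -> scanning (scan input g) p.+1 o.+1 cm.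
Proof.
move=> s_1 [mark inv markE]; have := scan_stepP input inv.
by rewrite s_1 /= addn0 addn1 => inv'; eexists; first exact: inv'.
Qed.

(** Beyond the end the symbol is 0, neither an address nor a terminator, so a pass only advances the
    position and may alter the meaningless mark of 0. *)
Lemma scanning_end (input : seq nat) (g : nat -> nat) (p o n : nat)
    (cm : nat * pred 'I_K) :
  size input <= p -> scanning g p o cm -> scanning (iter n (scan input) g) (n + p) o cm.
Proof.
move=> le_p inv; elim: n => [//|n [mark inv' markE]] /=.
have := scan_stepP input inv'; rewrite /symbol nth_default; last by lia.
by rewrite /= !addn0 => inv''; eexists; first exact: inv''.
Qed.

Lemma scanning_addrs (input pre post : seq nat) (l : seq 'I_K) (g : nat -> nat)
    (o : nat) (cm : nat * pred 'I_K) :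
  input = pre ++ [seq a.+2 | a : 'I_K <- l] ++ post -> scanning g (size pre) o cm ->
  scanning (iter (size l) (scan input) g) (size pre + size l) o
    (foldl (scan_addr (first_block i k o) (second_block i k o)) cm l).
Proof.
elim/last_ind: l post => [|l a IHl] post inputE inv; first by rewrite addn0.
rewrite size_rcons foldl_rcons addnS.
rewrite map_rcons cat_rcons in inputE.
apply: scanning_addr (IHl _ inputE inv).
rewrite /symbol inputE catA nth_cat size_cat size_map ltnn subnn.
by [].
Qed.

Lemma scanning_ops (input pre post : seq nat) (x : seq (seq 'I_K)) (g : nat -> nat)
    (o : nat) (cm : nat * pred 'I_K) :
  input = pre ++ encode x ++ post -> scanning g (size pre) o cm ->
  scanning (iter (size (encode x)) (scan input) g) (size pre + size (encode x))
    (o + size x) (scan_ops o cm x).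
Proof.
elim: x => [|l x IH] in pre g o cm *; first by rewrite /= !addn0.
rewrite encode_cons -catA => inputE inv.
have inv_l := scanning_addrs inputE inv.
have {inv_l} : scanning (scan input (iter (size l) (scan input) g))
    (size (pre ++ [seq a.+2 | a : 'I_K <- l] ++ [:: 1])) o.+1
    (foldl (scan_addr (first_block i k o) (second_block i k o)) cm l).
  rewrite !size_cat size_map addnA addn1; apply: scanning_term inv_l.
  by rewrite /symbol inputE catA nth_cat size_cat size_map ltnn subnn.
have inputE' : input = (pre ++ [seq a.+2 | a : 'I_K <- l] ++ [:: 1]) ++ encode x ++ post.
  by rewrite inputE -!catA.
move=> /(IH _ _ _ _ inputE'); rewrite -iterS -iterD !size_cat size_map /=.
set e := size (encode x).
have -> : e + (size l).+1 = size l + e.+1 by lia.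
have -> : size pre + (size l + 1) + e = size pre + (size l + e.+1) by lia.
by rewrite addSnnS.
Qed.

(** In the first block every address becomes marked. In the second one a marked cell is counted at
    its first occurrence and unmarked, so repeated probes count once. *)
Lemma scan_addr_phase (first second : bool) (cm : nat * pred 'I_K) (l : seq 'I_K) :
  ~~ (first && second) ->
  let cm' := foldl (scan_addr first second) cm l in
  cm'.1 = cm.1 + (if second then #|[pred a | cm.2 a && (a \in l)]| else 0) /\
  cm'.2 =1 [pred a | if first then cm.2 a || (a \in l)
                     else if second then cm.2 a && (a \notin l) else cm.2 a].
Proof.
move=> one_phase; elim: l => [|a l IH] /= in cm *.
  split=> [|b /=]; last by rewrite in_nil orbF /= andbT; case: (first); case: (second).
  by case: (second); rewrite ?addn0 // eq_card0 ?addn0 // => b; rewrite !inE andbF.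
have [-> markE] := IH (scan_addr first second cm a); split; last first.
  move=> b; rewrite markE /= inE; case: eqP => [->|_] //=.
  by case: first second one_phase {markE IH} => [] [] //= _; rewrite ?orbT ?andbF.
rewrite /= -addnA; congr (_ + _); case: second one_phase {markE IH} => //=.
case: first => // _; rewrite [RHS](cardD1 a) !inE eqxx andbT; congr (_ + _).
by apply: eq_card => b; rewrite !inE; case: eqP => //= _; rewrite andbF.
Qed.

Lemma scan_ops_phase (first second : bool) (o : nat) (cm : nat * pred 'I_K)
    (x : seq (seq 'I_K)) :
  (forall o', o <= o' < o + size x ->
    first_block i k o' = first /\ second_block i k o' = second) ->
  scan_ops o cm x = foldl (scan_addr first second) cm (flatten x).
Proof.
elim: x => [//|l x IH] /= in o cm *; move=> phase.
have [-> ->] := phase o ltac:(lia); rewrite foldl_cat IH // => o' lt_o.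
by apply: phase; lia.
Qed.

Lemma scan_ops_cat (o : nat) (cm : nat * pred 'I_K) (x y : seq (seq 'I_K)) :
  scan_ops o cm (x ++ y) = scan_ops (o + size x) (scan_ops o cm x) y.
Proof. by elim: x => [|l x IH] /= in o cm *; rewrite ?addn0 // IH addSnnS. Qed.

(** The sequence is cut before, between and after the two blocks. Operations outside them change
    neither marks nor count. *)
Lemma scan_ops_shared (x : seq (seq 'I_K)) :
  i + k + k <= size x -> (scan_ops 0 (0, fun=> false) x).1 = shared i k x.
Proof.
move=> le_x.
have xE : x = take i x ++ take k (drop i x) ++ take k (drop (i + k) x) ++
    drop (i + k + k) x.
  rewrite -{1}(cat_take_drop i x); congr (_ ++ _).
  rewrite -{1}(cat_take_drop k (drop i x)) drop_drop [k + i]addnC; congr (_ ++ _).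
  by rewrite -{1}(cat_take_drop k (drop (i + k) x)) drop_drop [k + (i + k)]addnC.
have sz0 : size (take i x) = i by rewrite size_take_min; lia.
have sz1 : size (take k (drop i x)) = k by rewrite size_take_min size_drop; lia.
have sz2 : size (take k (drop (i + k) x)) = k by rewrite size_take_min size_drop; lia.
rewrite {1}xE !scan_ops_cat sz0 sz1 sz2 add0n.
rewrite (@scan_ops_phase false true (i + k)); last first.
  by move=> o'; rewrite sz2 /first_block /second_block; lia.
rewrite (@scan_ops_phase true false i); last first.
  by move=> o'; rewrite sz1 /first_block /second_block; lia.
rewrite (@scan_ops_phase false false 0); last first.
  by move=> o'; rewrite sz0 /first_block /second_block; lia.
rewrite (@scan_ops_phase false false (i + k + k)); last first.
  by move=> o'; rewrite /first_block /second_block; lia.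
set l0 := flatten _; set l1 := flatten _; set l2 := flatten _; set l3 := flatten _.
set cm0 := foldl _ _ l0; set cm1 := foldl _ _ l1; set cm2 := foldl _ _ l2.
have [-> _] := @scan_addr_phase false false cm2 l3 isT.
have [-> _] := @scan_addr_phase false true cm1 l2 isT.
have [-> m1] := @scan_addr_phase true false cm0 l1 isT.
have [-> m0] := @scan_addr_phase false false (0, fun=> false) l0 isT.
by rewrite /= addn0; apply: eq_card => a; rewrite !inE m1 /= m0.
Qed.

End DistinguisherSpec.

Lemma size_encode (K : nat) (x : seq (seq 'I_K)) :
  size (encode x) = sumn (map size x) + size x.
Proof.
elim: x => [//|l x IH]; rewrite encode_cons size_cat size_map /= IH; lia.
Qed.

(** Addresses are shifted by 2 and terminators are 1, so 0 is read only beyond the end. *)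
Lemma encode_gt0 (K : nat) (x : seq (seq 'I_K)) (p : nat) :
  (0 < nth 0 (encode x) p) = (p < size (encode x)).
Proof.
elim: x => [|l x IH] in p *; first by rewrite nth_nil.
rewrite encode_cons nth_cat size_cat !size_map /=.
case: (ltnP p (size l)) => [lt_p|le_p].
  have /(all_nthP 0) pos : all (leq 1) [seq a.+2 | a : 'I_K <- l].
    by apply/allP => _ /mapP[b _ ->].
  by rewrite pos ?size_map //; lia.
rewrite -(subnKC le_p); move: (p - size l) => q.
by rewrite addKn ltn_add2l; case: q => [|q] //=; rewrite IH.
Qed.

Lemma nbits_le (c : nat) : nbits c <= c.+1.
Proof.
case: c => [//|c]; rewrite /nbits ltnS.
exact: leq_trans (ltnW (ltn_expl _ _)) (trunc_logP _ (ltn0Sn c)).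
Qed.

Lemma distinguisher_correct (K i k T N : nat) (x : seq (seq 'I_K)) :
  i + k + k <= size x ->
  let g := foldl (effect (encode x)) (fun=> 0) (distinguisher i k T N) in
  (g 0 != 0) = (N < size (encode x)) || (T < shared i k x).
Proof.
move=> le_x; rewrite /distinguisher !foldl_cat scan_iter.
set g0 := foldl _ _ (scan_init i k T).
have inv0 : @scanning K i k T g0 0 0 (0, fun=> false).
  exists (fun=> false) => //.
  split; [split | split | split | move=> s] => //.
  rewrite /g0 /= /set_reg !ifN_eq //; lia.
(* If the scan stops early, nothing is claimed about the count [c]: the unread symbol at position
   [N] already makes the output nonzero. *)
have [o [c [mark [inv c_eq]]]] : exists o c mark,
    scan_inv i k T (iter N (scan (encode x)) g0) N o c mark /\
    (size (encode x) <= N -> c = shared i k x).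
  case: (leqP (size (encode x)) N) => [le_N|_].
    have input_eq : encode x = [::] ++ encode x ++ [::] by rewrite cats0.
    have := scanning_ops input_eq inv0; rewrite !add0n.
    move=> /(scanning_end (N - size (encode x)) (leqnn _)).
    rewrite -iterD subnK // => -[mark inv _]; do 3 eexists; split; first exact: inv.
    by rewrite scan_ops_shared.
  elim: {1 2}N => [|n [o [c [mark [inv _]]]]].
    by case: inv0 => mark inv _; do 3 eexists; split; first exact: inv.
  by do 3 eexists; split; first exact: (scan_stepP (encode x) inv).
case: inv; set g := iter _ _ _ => -[g2 _ g4] [_ _ g17] _ _.
rewrite -[foldl _ _ _]/(set_reg _ 0 (g 4 - g 17 + symbol (encode x) (g 2))).
rewrite /set_reg eqxx g2 g4 g17 addn_eq0 negb_and -lt0n subn_gt0 -lt0n encode_gt0.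
by rewrite orbC; case: ltnP => //= le_N; rewrite c_eq.
Qed.

Lemma program_size_scan_step : program_size scan_step <= 1000.
Proof. by rewrite /program_size !big_cons big_nil; vm_compute. Qed.

Lemma program_size_distinguisher (i k T N : nat) :
  program_size (distinguisher i k T N) <= 3 * (i + k + k) + T + (N + 1) * 1000.
Proof.
rewrite /program_size /distinguisher !big_cat /=.
have -> : \sum_(ins <- flatten (nseq N scan_step)) instr_size ins = N * program_size scan_step.
  elim: N => [|N IH]; first by rewrite big_nil.
  by rewrite big_cat /= IH mulSn.
have step_le := program_size_scan_step.
have out : \sum_(ins <- scan_output) instr_size ins <= 100.
  by rewrite !big_cons big_nil; vm_compute.
have init : \sum_(ins <- scan_init i k T) instr_size ins <= 3 * (i + k + k) + T + 200.
  rewrite !big_cons big_nil /= -[nbits 5]/3 -[nbits 1]/1 -[nbits 6]/3 -[nbits 20]/5.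
  rewrite -[nbits 14]/4 -[nbits 15]/4 -[nbits 16]/5 -[nbits 17]/5.
  have := nbits_le i; have := nbits_le (i + k); have := nbits_le (i + k + k).
  have := nbits_le T; lia.
have : N * program_size scan_step <= N * 1000 by rewrite leq_mul2l step_le orbT.
lia.
Qed.

Lemma computable_distinguisher (K i k T N t M : nat) :
  i + k + k <= M -> 3 * M + T + (N + 1) * 1000 <= t ->
  computable_within t M (fun x : seq (seq 'I_K) =>
    (N < size (encode x)) || (T < shared i k x)).
Proof.
move=> le_M le_t; exists (distinguisher i k T N).
  by have := program_size_distinguisher i k T N; lia.
have le_p : size (distinguisher i k T N) <= t.
  have : size (distinguisher i k T N) <= program_size (distinguisher i k T N).
    rewrite /program_size -sum1_size; apply: leq_sum => -[] //.
  by have := program_size_distinguisher i k T N; lia.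
have nj : all no_jump (distinguisher i k T N).
  by rewrite !all_cat /= andbT; elim: N {le_t le_p} => [//|N IH]; rewrite /= IH.
move=> x size_x; rewrite ram_run_straight_line // distinguisher_correct //.
by rewrite size_x.
Qed.

(** * Hard operation sequences *)

Section Runs.

Variable P : problem.
Implicit Types (s : state P) (y z : seq (op P)) (l : seq (option (ans P))).

(** Since [correct_from] does not return the final state, arbitrary continuations [z] are used to
    express it; this form composes under concatenation. *)
Definition runs s y s' l : Prop :=
  forall z, correct_from s (y ++ z) = omap (cat l) (correct_from s' z).

Lemma runs_nil s : runs s [::] s [::].
Proof. by move=> z; case: correct_from. Qed.

Lemma runs_cons s o s1 a y s' l :
  step s o = Some (s1, a) -> runs s1 y s' l -> runs s (o :: y) s' (a :: l).
Proof. by move=> stepE run_y z; rewrite /= stepE run_y; case: correct_from. Qed.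

Lemma runs_cat s y1 s1 l1 y2 s2 l2 :
  runs s y1 s1 l1 -> runs s1 y2 s2 l2 -> runs s (y1 ++ y2) s2 (l1 ++ l2).
Proof.
move=> run1 run2 z; rewrite -catA run1 run2; case: correct_from => //= l.
by rewrite catA.
Qed.

Lemma runs_correct y s l : runs (init P) y s l -> correct_answers y = Some l.
Proof. by move=> /(_ [::]); rewrite /correct_answers cats0 /= cats0. Qed.

Lemma size_correct_from s y l : correct_from s y = Some l -> size l = size y.
Proof.
elim: y => [|o y IH] in s l *; first by case=> <-.
rewrite /=; case: step => [[s1 a]|//]; case E: correct_from => [l'|//] [<-] /=.
by rewrite (IH _ _ E).
Qed.

Lemma size_runs s y s' l : runs s y s' l -> size l = size y.
Proof. by move=> /(_ [::]); rewrite cats0 /= cats0 => /size_correct_from. Qed.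

Fixpoint alternate {T : Type} (t : nat) (o1 o2 : T) : seq T :=
  if t is t'.+1 then o1 :: alternate t' o2 o1 else [::].

Lemma size_alternate (T : Type) t (o1 o2 : T) : size (alternate t o1 o2) = t.
Proof. by elim: t o1 o2 => //= t IH o1 o2; rewrite IH. Qed.

(** Such pairs provide padding of any length: alternating the two operations is always permitted and
    restores [s] after an even number of them. Hence blocks start at even positions. *)
Definition undone s (o1 o2 : op P) : Prop :=
  exists s' a b, step s o1 = Some (s', a) /\ step s' o2 = Some (s, b).

Lemma runs_alternate s o1 o2 t :
  undone s o1 o2 -> exists s' l, runs s (alternate t o1 o2) s' l /\ (~~ odd t -> s' = s).
Proof.
move=> [s1 [a [b [step1 step2]]]].
exists (if odd t then s1 else s), (alternate t a b); split; last by case: odd.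
elim: t s s1 o1 o2 a b step1 step2 => [|t IH] s s1 o1 o2 a b step1 step2 /=.
  exact: runs_nil.
by rewrite if_neg; apply: runs_cons step1 (IH _ _ _ _ _ _ step2 step1).
Qed.

(* The prefix, the queries and the suffix do not depend on [x], so only the block
   [ins x] carries information about it. *)
Definition hard_instance (n r i k : nat) : Prop :=
  exists (pre : seq (op P)) (ins : {ffun 'I_k -> elt r} -> seq (op P))
    (qry suf : seq (op P)) (g : 'I_k -> elt r -> ans P),
  [/\ size pre = i, forall x, size (ins x) = k, size qry = k &
      i + k + k + size suf = n] /\
  (forall j, injective (g j)) /\
  forall x, exists2 l, correct_answers (pre ++ ins x ++ qry ++ suf) = Some l &
    forall j : 'I_k, nth None l (i + k + j) = Some (g j (x j)).

Lemma hard_instance_intro (n r i k : nat) (o1 o2 : op P)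
    (ins : {ffun 'I_k -> elt r} -> seq (op P)) (qry : seq (op P))
    (g : 'I_k -> elt r -> ans P) :
  ~~ odd i -> i + k + k <= n -> undone (init P) o1 o2 ->
  (forall x, size (ins x) = k) -> size qry = k -> (forall j, injective (g j)) ->
  (forall x, exists s1 s2 l1 l2, [/\ runs (init P) (ins x) s1 l1, runs s1 qry s2 l2,
     undone s2 o1 o2 & forall j : 'I_k, nth None l2 j = Some (g j (x j))]) ->
  hard_instance n r i k.
Proof.
move=> even_i le_n init_o size_ins size_qry inj_g run_x.
have [s0 [l0 [run0 /(_ even_i) s0E]]] := runs_alternate i init_o.
exists (alternate i o1 o2), ins, qry, (alternate (n - (i + k + k)) o1 o2), g.
rewrite !size_alternate; split; [by split=> //; rewrite subnKC | split=> // x].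
have [s1 [s2 [l1 [l2 [run1 run2 s2_o nth_l2]]]]] := run_x x.
have [s3 [l3 [run3 _]]] := runs_alternate (n - (i + k + k)) s2_o.
rewrite s0E in run0.
exists (l0 ++ l1 ++ l2 ++ l3).
  exact: runs_correct (runs_cat run0 (runs_cat run1 (runs_cat run2 run3))).
move=> j; rewrite catA nth_cat size_cat (size_runs run0) (size_runs run1).
rewrite size_alternate size_ins ltnNge leq_addr /= addKn nth_cat (size_runs run2).
by rewrite size_qry ltn_ord nth_l2.
Qed.

End Runs.

Lemma nth_map_codom (k : nat) (T U : Type) (x : {ffun 'I_k -> T}) (h : T -> U) (u0 : U)
    (j : 'I_k) :
  nth u0 [seq h e | e <- codom x] j = h (x j).
Proof.
by rewrite -map_comp (nth_map j) ?size_enum_ord // nth_ord_enum.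
Qed.

(** * Hard instances for stacks, queues and deques *)

Section Linear.

Variables n r : nat.
Implicit Types (s xs : seq (elt r)).

Lemma stack_pushes s xs : size s + size xs <= n ->
  @runs (stack n r) s (map (@Push r) xs) (catrev xs s) (nseq (size xs) None).
Proof.
elim: xs s => [|x xs IH] s /= le_n; first exact: runs_nil.
by apply: runs_cons (IH (x :: s) _); rewrite /= ?ifT //; lia.
Qed.

Lemma stack_pops s xs :
  @runs (stack n r) (xs ++ s) (nseq (size xs) Pop) s (map some xs).
Proof.
by elim: xs => [|x xs IH] /=; [apply: runs_nil | apply: runs_cons IH].
Qed.

Lemma stack_hard i k : 0 < n -> ~~ odd i -> i + k + k <= n ->
  hard_instance (stack n r) n r i k.
Proof.
move=> n_gt0 even_i le_n; pose x0 : elt r := nseq_tuple r false.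
have init_o : @undone (stack n r) [::] (Push x0) Pop.
  by exists [:: x0], None, (Some x0); rewrite /= n_gt0.
(* Pushing in reverse order makes the [j]-th pop return [x j]. *)
apply: (@hard_instance_intro (stack n r) n r i k _ _ (fun x => map (@Push r) (rev (codom x)))
    (nseq k Pop) (fun _ => id) even_i le_n init_o) => //.
- by move=> x; rewrite size_map size_rev size_codom card_ord.
- by rewrite size_nseq.
- by move=> j x y.
move=> x; have size_x : size (codom x) = k by rewrite size_codom card_ord.
exists (codom x), [::], (nseq (size (rev (codom x))) None), (map some (codom x)).
split=> //; last by move=> j; rewrite nth_map_codom.
  rewrite -[s in runs _ _ s _]revK; apply: stack_pushes.
  by rewrite size_rev size_x /=; lia.
by rewrite -[s in runs s]cats0 -[in nseq k]size_x; apply: stack_pops.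
Qed.

Lemma queue_enqueues s xs : size s + size xs <= n ->
  @runs (queue n r) s (map (@Enqueue r) xs) (s ++ xs) (nseq (size xs) None).
Proof.
elim: xs s => [|x xs IH] s /= le_n; first by rewrite cats0; apply: runs_nil.
by rewrite -cat_rcons; apply: runs_cons (IH _ _); rewrite /= ?size_rcons ?ifT //; lia.
Qed.

Lemma queue_dequeues s xs :
  @runs (queue n r) (xs ++ s) (nseq (size xs) Dequeue) s (map some xs).
Proof.
by elim: xs => [|x xs IH] /=; [apply: runs_nil | apply: runs_cons IH].
Qed.

Lemma queue_hard i k : 0 < n -> ~~ odd i -> i + k + k <= n ->
  hard_instance (queue n r) n r i k.
Proof.
move=> n_gt0 even_i le_n; pose x0 : elt r := nseq_tuple r false.
have init_o : @undone (queue n r) [::] (Enqueue x0) Dequeue.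
  by exists [:: x0], None, (Some x0); rewrite /= n_gt0.
apply: (@hard_instance_intro (queue n r) n r i k _ _ (fun x => map (@Enqueue r) (codom x))
    (nseq k Dequeue) (fun _ => id) even_i le_n init_o) => //.
- by move=> x; rewrite size_map size_codom card_ord.
- by rewrite size_nseq.
- by move=> j x y.
move=> x; have size_x : size (codom x) = k by rewrite size_codom card_ord.
exists (codom x), [::], (nseq (size (codom x)) None), (map some (codom x)).
split=> //; last by move=> j; rewrite nth_map_codom.
  by apply: (@queue_enqueues [::]); rewrite size_x /=; lia.
by rewrite -[s in runs s]cats0 -[in nseq k]size_x; apply: queue_dequeues.
Qed.

(** The deque is used as a stack, at its front end only. *)
Lemma deque_pushes s xs : size s + size xs <= n ->
  @runs (deque n r) s (map (@PushFront r) xs) (catrev xs s) (nseq (size xs) None).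
Proof.
elim: xs s => [|x xs IH] s /= le_n; first exact: runs_nil.
by apply: runs_cons (IH (x :: s) _); rewrite /= ?ifT //; lia.
Qed.

Lemma deque_pops s xs :
  @runs (deque n r) (xs ++ s) (nseq (size xs) PopFront) s (map some xs).
Proof.
by elim: xs => [|x xs IH] /=; [apply: runs_nil | apply: runs_cons IH].
Qed.

Lemma deque_hard i k : 0 < n -> ~~ odd i -> i + k + k <= n ->
  hard_instance (deque n r) n r i k.
Proof.
move=> n_gt0 even_i le_n; pose x0 : elt r := nseq_tuple r false.
have init_o : @undone (deque n r) [::] (PushFront x0) PopFront.
  by exists [:: x0], None, (Some x0); rewrite /= n_gt0.
apply: (@hard_instance_intro (deque n r) n r i k _ _ (fun x => map (@PushFront r) (rev (codom x)))
    (nseq k PopFront) (fun _ => id) even_i le_n init_o) => //.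
- by move=> x; rewrite size_map size_rev size_codom card_ord.
- by rewrite size_nseq.
- by move=> j x y.
move=> x; have size_x : size (codom x) = k by rewrite size_codom card_ord.
exists (codom x), [::], (nseq (size (rev (codom x))) None), (map some (codom x)).
split=> //; last by move=> j; rewrite nth_map_codom.
  rewrite -[s in runs _ _ s _]revK; apply: deque_pushes.
  by rewrite size_rev size_x /=; lia.
by rewrite -[s in runs s]cats0 -[in nseq k]size_x; apply: deque_pops.
Qed.

End Linear.

(** * Hard instances for priority queues and search trees *)

Section Dictionary.

Variables n u r : nat.
Hypothesis u_gt0 : 0 < u.
Implicit Types (X : nat -> elt r).

Definition key (p : nat) : 'I_u := insubd (Ordinal u_gt0) p.

Lemma val_key p : p < u -> key p = p :> nat.
Proof. by move=> lt_p; rewrite /key insubdK. Qed.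

Lemma ord_segment a b : a <= b -> b <= u ->
  map val [seq p : 'I_u <- enum 'I_u | a <= p < b] = iota a (b - a).
Proof.
move=> le_ab le_bu; rewrite -(filter_map val (fun p => a <= p < b)) val_enum_ord.
have -> : u = a + ((b - a) + (u - b)) by lia.
rewrite !iotaD !filter_cat add0n.
rewrite (eq_in_filter (a2 := pred0)) ?filter_pred0; last first.
  by move=> p; rewrite mem_iota /=; lia.
rewrite [X in _ ++ X ++ _](eq_in_filter (a2 := predT)) ?filter_predT; last first.
  by move=> p; rewrite mem_iota /=; lia.
rewrite [X in _ ++ _ ++ X](eq_in_filter (a2 := pred0)) ?filter_pred0 ?cats0 //.
by move=> p; rewrite mem_iota /=; lia.
Qed.

Lemma ohead_ord_segment a b : a < b -> b <= u ->
  ohead [seq p : 'I_u <- enum 'I_u | a <= p < b] = Some (key a).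
Proof.
move=> lt_ab le_bu; have := ord_segment (ltnW lt_ab) le_bu.
rewrite -(subnSK lt_ab) /=; case: filter => [//|p s] /= [val_p _].
by congr Some; apply: val_inj; rewrite /= val_key //; lia.
Qed.

(** In the hard instances the stored keys always form an interval. *)
Definition segment X a b : dict u r :=
  [ffun p : 'I_u => if a <= p < b then Some (X p) else None].

Lemma keys_segment X a b :
  keys (segment X a b) = [seq p : 'I_u <- enum 'I_u | a <= p < b].
Proof. by apply: eq_filter => p; rewrite ffunE; case: ifP. Qed.

Lemma size_keys_segment X a b : a <= b -> b <= u -> size (keys (segment X a b)) = b - a.
Proof.
move=> le_ab le_bu; rewrite keys_segment -(size_map val) ord_segment //.
exact: size_iota.
Qed.

Lemma segment_nil X a : segment X a a = [ffun=> None].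
Proof. by apply/ffunP => p; rewrite !ffunE; case: ifP => //; lia. Qed.

Lemma segment_key X a b p : p < u ->
  segment X a b (key p) = if a <= p < b then Some (X p) else None.
Proof. by move=> lt_p; rewrite ffunE val_key. Qed.

Lemma insert_segment X a b : a <= b -> b - a < n -> b < u ->
  insert n (segment X a b) (key b) (X b) = Some (segment X a b.+1).
Proof.
move=> le_ab lt_n lt_u; rewrite /insert size_keys_segment ?(ltnW lt_u) // lt_n segment_key //.
rewrite ltnn andbF /=; congr Some; apply/ffunP => p; rewrite !ffunE.
case: eqP => [->|ne_p]; first by rewrite val_key // ltnSn le_ab.
have {}ne_p : p <> b :> nat by move=> p_b; apply: ne_p; apply: val_inj; rewrite /= val_key.
by rewrite (_ : p < b.+1 = (p < b)) //; lia.
Qed.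

Lemma delete_segment X a b : a < u ->
  update (segment X a b) (key a) None = segment X a.+1 b.
Proof.
move=> lt_u; apply/ffunP => p; rewrite !ffunE.
case: eqP => [->|ne_p]; first by rewrite val_key // ltnn.
have {}ne_p : p <> a :> nat by move=> p_a; apply: ne_p; apply: val_inj; rewrite /= val_key.
by rewrite (_ : a < p = (a <= p)) //; lia.
Qed.

Lemma pq_inserts X a c : a + c <= n -> a + c <= u ->
  @runs (priority_queue n u r) (segment X 0 a)
    [seq PQInsert (key p) (X p) | p <- iota a c] (segment X 0 (a + c)) (nseq c None).
Proof.
elim: c a => [|c IH] a le_n le_u /=; first by rewrite addn0; apply: runs_nil.
rewrite -addSnnS; apply: runs_cons (IH a.+1 _ _); try lia.
by rewrite /= insert_segment //; lia.
Qed.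

Lemma pq_extracts X a c : a + c <= u ->
  @runs (priority_queue n u r) (segment X a (a + c)) (nseq c ExtractMin)
    (segment X (a + c) (a + c)) [seq Some (X p) | p <- iota a c].
Proof.
elim: c a => [|c IH] a le_u /=; first by rewrite addn0; apply: runs_nil.
rewrite -addSnnS; apply: runs_cons (IH a.+1 _); last by lia.
rewrite /= keys_segment ohead_ord_segment; [|lia|lia].
by rewrite /= delete_segment ?segment_key ?leqnn; [rewrite ifT //|..]; lia.
Qed.

Lemma tree_inserts X a c : a + c <= n -> a + c <= u ->
  @runs (search_tree n u r) (segment X 0 a)
    [seq Insert (key p) (X p) | p <- iota a c] (segment X 0 (a + c)) (nseq c None).
Proof.
elim: c a => [|c IH] a le_n le_u /=; first by rewrite addn0; apply: runs_nil.
rewrite -addSnnS; apply: runs_cons (IH a.+1 _ _); try lia.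
by rewrite /= insert_segment //; lia.
Qed.

(** A stored key is its own successor, so the query returns the element inserted with it. *)
Lemma tree_successors X b a c : a + c <= b -> b <= u ->
  @runs (search_tree n u r) (segment X 0 b)
    [seq Successor (key p) | p <- iota a c] (segment X 0 b)
    [seq Some (Some (key p, X p)) | p <- iota a c].
Proof.
elim: c a => [|c IH] a le_b le_u /=; first exact: runs_nil.
apply: runs_cons (IH a.+1 _ _); try lia.
rewrite /= keys_segment -filter_predI.
rewrite (eq_filter (a2 := fun p : 'I_u => a <= p < b)); last first.
  by move=> p; rewrite /= val_key; lia.
rewrite ohead_ord_segment; [|lia|lia].
by rewrite /= /lookup segment_key ?ifT //; lia.
Qed.

Lemma nth_map_iota (k : nat) (T : Type) (f : nat -> T) (t0 : T) (j : 'I_k) :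
  nth t0 [seq f p | p <- iota 0 k] j = f j.
Proof. by rewrite (nth_map 0) ?size_iota // nth_iota. Qed.

Definition extend {k : nat} (x : {ffun 'I_k -> elt r}) (p : nat) : elt r :=
  nth (nseq_tuple r false : elt r) (codom x) p.

Lemma extend_ord (k : nat) (x : {ffun 'I_k -> elt r}) (j : 'I_k) : extend x j = x j.
Proof. by rewrite /extend (nth_map j) ?size_enum_ord // nth_ord_enum. Qed.

Lemma pq_hard i k : 0 < n -> n <= u -> ~~ odd i -> i + k + k <= n ->
  hard_instance (priority_queue n u r) n r i k.
Proof.
move=> n_gt0 le_nu even_i le_n; pose x0 : elt r := nseq_tuple r false.
have init_o : @undone (priority_queue n u r) [ffun=> None] (PQInsert (key 0) x0) ExtractMin.
  exists (segment (fun=> x0) 0 1), None, (Some x0).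
  rewrite /= -(segment_nil (fun=> x0) 0) insert_segment // keys_segment.
  rewrite ohead_ord_segment //= segment_key //= delete_segment //.
  by rewrite !segment_nil.
apply: (@hard_instance_intro (priority_queue n u r) n r i k _ _
  (fun x => [seq PQInsert (key p) (extend x p) | p <- iota 0 k])
  (nseq k ExtractMin) (fun _ => id) even_i le_n init_o) => //.
- by move=> x; rewrite size_map size_iota.
- by rewrite size_nseq.
- by move=> j x y.
move=> x; exists (segment (extend x) 0 k), [ffun=> None], (nseq k None).
exists [seq Some (extend x p) | p <- iota 0 k]; split=> //.
- by have := @pq_inserts (extend x) 0 k; rewrite segment_nil; apply; lia.
- by rewrite -(segment_nil (extend x) k); apply: (@pq_extracts _ 0); lia.
- by move=> j; rewrite nth_map_iota extend_ord.
Qed.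

Lemma tree_hard i k : 0 < n -> n <= u -> ~~ odd i -> i + k + k <= n ->
  hard_instance (search_tree n u r) n r i k.
Proof.
move=> n_gt0 le_nu even_i le_n.
(* A query leaves the state unchanged and therefore undoes itself. *)
have pred_o s : @undone (search_tree n u r) s (Predecessor (key 0)) (Predecessor (key 0)).
  by do 3 eexists; split; reflexivity.
apply: (@hard_instance_intro (search_tree n u r) n r i k _ _
  (fun x => [seq Insert (key p) (extend x p) | p <- iota 0 k])
  [seq Successor (key p) | p <- iota 0 k]
  (fun j e => Some (key j, e)) even_i le_n (pred_o _)).
- by move=> x; rewrite size_map size_iota.
- by rewrite size_map size_iota.
- by move=> j x y [].
move=> x; exists (segment (extend x) 0 k), (segment (extend x) 0 k), (nseq k None).
exists [seq Some (Some (key p, extend x p)) | p <- iota 0 k]; split=> //.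
- by have := @tree_inserts (extend x) 0 k; rewrite segment_nil; apply; lia.
- by apply: tree_successors; lia.
- by move=> j; rewrite nth_map_iota extend_ord.
Qed.

End Dictionary.

Lemma problem_hard (kind : ds_kind) (n u r i k : nat) :
  0 < n -> n <= u -> ~~ odd i -> i + k + k <= n ->
  hard_instance (problem_of kind n u r) n r i k.
Proof.
case: kind => n_gt0 le_nu.
- exact: stack_hard.
- exact: queue_hard.
- exact: deque_hard.
- exact: pq_hard (leq_trans n_gt0 le_nu) _ _ n_gt0 le_nu.
- exact: tree_hard (leq_trans n_gt0 le_nu) _ _ n_gt0 le_nu.
Qed.

(** Distinct elements give distinct insertions. Thus a time bound polynomial in the logarithm of the
    number of operations may also depend polynomially on [r]. *)
Lemma le_up_log_op (kind : ds_kind) (n u r : nat) :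
  0 < u -> r <= up_log 2 #|op (problem_of kind n u r)|.
Proof.
move=> u_gt0.
have [f inj_f] : exists f : elt r -> op (problem_of kind n u r), injective f.
  case: kind => /=.
  - by exists (@Push r) => x y [].
  - by exists (@Enqueue r) => x y [].
  - by exists (@PushFront r) => x y [].
  - by exists (PQInsert (key u_gt0 0)) => x y [].
  - by exists (Insert (key u_gt0 0)) => x y [].
have := leq_card f inj_f; rewrite card_tuple card_bool => le_card.
by rewrite -(@leq_exp2l 2) // (leq_trans le_card) // up_logP.
Qed.

(** * Information transfer between adjacent blocks *)

(** A message and 6 bits of slack must fit into the fraction 1/315 of the [b] bits of input that is
    saved by [few_mismatches]. As 3780 is 12 times 315, the slack, the client memory and the patch
    take at most [b / 2], [b / 12] and [b / 4]. *)
Lemma message_bits (m w t b : nat) :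
  0 < m -> 3780 * m <= b -> t * (3780 * w) <= b ->
  (6 + (m + 3 * w * t)) * 315 <= b.
Proof.
have -> : t * (3780 * w) = 3780 * (w * t) by lia.
by rewrite -mulnA; move: (w * t) => wt; lia.
Qed.

Section Encoding.

Variables (P : problem) (w m : nat) (D : data_structure P w m).
Variables (r i k : nat) (pre : seq (op P)) (ins : {ffun 'I_k -> elt r} -> seq (op P)).
Variables (qry suf : seq (op P)) (g : 'I_k -> elt r -> ans P).
Hypotheses (size_pre : size pre = i) (size_ins : forall x, size (ins x) = k).
Hypotheses (size_qry : size qry = k) (inj_g : forall j, injective (g j)).
Hypotheses (r_gt0 : 0 < r) (w_gt0 : 0 < w) (m_gt0 : 0 < m).
Hypothesis m_small : 3780 * m <= r * k.

Definition block_sequence (x : {ffun 'I_k -> elt r}) : seq (op P) :=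
  pre ++ ins x ++ qry ++ suf.

Definition block_answer (x : {ffun 'I_k -> elt r}) (rho : (coins D).-tuple bool) (j : 'I_k) :=
  nth None (answers D (block_sequence x) rho) (i + k + j).

Definition sharing (x : {ffun 'I_k -> elt r}) (rho : (coins D).-tuple bool) : nat :=
  shared i k (probes D (block_sequence x) rho).

(** The memory [mem0] is determined by the coins, because [pre] does not depend on [x]. So [c] and
    the patch are all that a decoder has to be told about [x]. *)
Lemma block_decoding (T : nat) (x : {ffun 'I_k -> elt r}) (rho : (coins D).-tuple bool) :
  let mem0 := (state_after rho (server0 D) (client0 D) pre).1 in
  sharing x rho <= T ->
  exists (c : client m) (pt : T.-tuple (option ('I_(cells D) * cell w))),
    forall j, block_answer x rho j =
      nth None (unzip2 (execute rho (patch pt mem0) c qry)) j.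
Proof.
rewrite /sharing /shared /block_answer /probes /answers /block_sequence !execute_cat.
case E0: (state_after rho _ _ pre) => [mem0 c0] /=.
case E1: (state_after rho mem0 c0 (ins x)) => [mem1 c1] /=.
set e0 := execute rho _ _ pre; set e1 := execute rho mem0 c0 _.
set e2 := execute rho mem1 c1 qry; set e3 := execute rho _ _ suf.
have sz0 : size e0 = i by rewrite size_execute.
have sz1 : size e1 = k by rewrite size_execute.
have sz2 : size e2 = k by rewrite size_execute.
have block1 : probed_at (unzip1 (e0 ++ e1 ++ e2 ++ e3)) i k = touched rho mem0 c0 (ins x).
  rewrite /probed_at /unzip1 !map_cat drop_size_cat ?size_map // take_size_cat ?size_map //.
have block2 : probed_at (unzip1 (e0 ++ e1 ++ e2 ++ e3)) (i + k) k = touched rho mem1 c1 qry.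
  rewrite /probed_at /unzip1 !map_cat catA drop_size_cat ?size_cat ?size_map ?sz0 ?sz1 //.
  by rewrite take_size_cat ?size_map.
rewrite block1 block2 => le_T.
have := @answers_from_patch _ _ _ D rho T mem0 c0 (ins x) qry; rewrite E1.
case/(_ le_T) => pt e2E; exists c1, pt => j.
rewrite -e2E -/e2 /unzip2 !map_cat catA nth_cat size_cat !size_map sz0 sz1.
by rewrite ltnNge leq_addr /= addKn nth_cat size_map sz2 ltn_ord.
Qed.

Definition few_errors (x : {ffun 'I_k -> elt r}) (rho : (coins D).-tuple bool) : bool :=
  15 * mismatches g (block_answer x rho) x <= 7 * k.

Let T := (r * k) %/ (3780 * w).

(** An entry is an address and contents of at most [w] bits each, or [None], which makes at most
    [2 ^ (2 * w) + 1 <= 2 ^ (3 * w)] possibilities. *)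
Lemma card_client_patch : #|{: client m * T.-tuple (option ('I_(cells D) * cell w))}|
  <= 2 ^ (m + 3 * w * T).
Proof.
rewrite card_prod !card_tuple card_bool card_option card_prod card_tuple card_bool card_ord.
rewrite expnD leq_mul2l expnM; apply/orP; right; apply: leq_expn2r.
have : cells D * 2 ^ w <= 2 ^ w * 2 ^ w by rewrite leq_mul2r cells_le orbT.
rewrite -expnD => le_c; apply: (@leq_trans (2 ^ (w + w)).+1) => //.
rewrite -addn1; apply: (@leq_trans (2 ^ (w + w) + 2 ^ (w + w))).
  by rewrite leq_add2l expn_gt0.
by rewrite addnn -mul2n -expnS leq_exp2l //; lia.
Qed.

(** Union bound over the messages: for fixed coins every such input has few mismatches with the
    answers decoded from some message, and [few_mismatches] limits the inputs close to each. *)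
Lemma few_uninformative (rho : (coins D).-tuple bool) :
  64 * #|[pred x | few_errors x rho && (sharing x rho <= T)]| <= 2 ^ (r * k).
Proof.
set Z := #|_|.
pose mem0 := (state_after rho (server0 D) (client0 D) pre).1.
pose msg := (client m * T.-tuple (option ('I_(cells D) * cell w)))%type.
pose dec (cp : msg) (j : 'I_k) :=
  nth None (unzip2 (execute rho (patch cp.2 mem0) cp.1 qry)) j.
pose close (cp : msg) := #|[pred x | 15 * mismatches g (dec cp) x <= 7 * k]|.
have msg0 : msg by exact: (client0 D, nseq_tuple T None).
(* The message with the most close inputs bounds all the others. *)
pose cp1 := [arg max_(cp > msg0) close cp].
have le_Z : Z <= 2 ^ (m + 3 * w * T) * close cp1.
  apply: leq_trans (_ : \sum_(cp : msg) close cp <= _); last first.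
    apply: leq_trans (_ : #|{: msg}| * close cp1 <= _); last first.
      by rewrite leq_mul2r card_client_patch orbT.
    rewrite -sum_nat_const; apply: leq_sum => cp _.
    by rewrite /cp1; case: arg_maxnP => // cp' _ /(_ cp isT).
  rewrite /Z -sum1_card /close.
  under [leqRHS]eq_bigr do rewrite -sum1_card.
  rewrite [leqRHS](exchange_big_dep predT) //= [leqLHS]big_mkcond; apply: leq_sum => x _ /=.
  case: ifP => //; rewrite inE => /andP[few /block_decoding[c [pt decE]]].
  have close_x : 15 * mismatches g (dec (c, pt)) x <= 7 * k.
    move: few; rewrite /few_errors /mismatches; congr (15 * _ <= _).
    by apply: eq_card => j; rewrite !inE decE.
  by rewrite (bigD1 (c, pt)) //= inE.
have := few_mismatches (dec cp1) inj_g r_gt0; rewrite -/(close cp1) => close_small.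
rewrite -(@leq_exp2r _ _ 315) // -expnM [_ * 315]mulnC.
rewrite -(@leq_pmul2r (2 ^ (r * k))) ?expn_gt0 //.
have step1 : (64 * Z) ^ 315 <= (2 ^ (6 + (m + 3 * w * T)) * close cp1) ^ 315.
  by apply: leq_expn2r; rewrite expnD -mulnA leq_mul2l le_Z orbT.
apply: (@leq_trans ((2 ^ (6 + (m + 3 * w * T)) * close cp1) ^ 315 * 2 ^ (r * k))).
  by rewrite leq_mul2r step1 orbT.
rewrite expnMn -mulnA.
apply: (@leq_trans ((2 ^ (6 + (m + 3 * w * T))) ^ 315 * 2 ^ (315 * (r * k)))).
  by rewrite leq_mul2l close_small orbT.
rewrite [2 ^ (315 * _) * _]mulnC leq_mul2r -expnM leq_exp2l //; apply/orP; right.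
apply: message_bits => //; exact: leq_trunc_div.
Qed.

Hypothesis block_correct : forall x j,
  3 * #|[pred rho | block_answer x rho j != Some (g j (x j))]| <= #|{: (coins D).-tuple bool}|.

(** Markov's inequality: the expected error rate is at most 1/3, so a rate above 7/15 has
    probability at most 5/7. *)
Lemma often_few_errors (x : {ffun 'I_k -> elt r}) :
  2 * #|{: (coins D).-tuple bool}| <= 7 * #|[pred rho | few_errors x rho]|.
Proof.
have k_gt0 : 0 < k by case: k m_small => //; rewrite muln0; lia.
set Q := #|_|; set G := #|_|.
pose mis rho := mismatches g (block_answer x rho) x.
have total : 3 * \sum_rho mis rho <= k * Q.
  rewrite /mis /mismatches; under eq_bigr do rewrite -sum1_card.
  rewrite (exchange_big_dep predT) //= big_distrr /=.
  have -> : k * Q = \sum_(j < k) Q by rewrite sum_nat_const card_ord.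
  apply: leq_sum => j _.
  rewrite sum1_card; apply: leq_trans (block_correct x j).
  by rewrite leq_mul2l; apply/eq_leq/eq_card.
have markov : 7 * k * #|[predC [pred rho | few_errors x rho]]| <= 15 * \sum_rho mis rho.
  rewrite mulnC -sum_nat_const big_distrr /= big_mkcond /=; apply: leq_sum => rho _.
  by case: ifP => //; rewrite !inE /few_errors -ltnNge => /ltnW.
have := cardC [pred rho | few_errors x rho]; rewrite -/Q -/G => cardQ.
move: markov total cardQ; set B := #|[predC _]|; set M := \sum_rho _.
move=> markov total cardQ.
have : k * (7 * B) <= k * (5 * Q) by lia.
by rewrite leq_pmul2l //; lia.
Qed.

(** On average over inputs and coins, few errors occur with probability at least 2/7, and few errors
    with little sharing at most 1/64. The difference is 121/448, and some input attains the
    average. *)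
Lemma exists_informative_input :
  exists x : {ffun 'I_k -> elt r},
    121 * #|{: (coins D).-tuple bool}| <= 448 * #|[pred rho | T < sharing x rho]|.
Proof.
set Q := #|_|; pose F x := #|[pred rho | T < sharing x rho]|.
suff : 121 * Q * 2 ^ (r * k) <= 448 * \sum_x F x.
  move=> avg; pose x1 := [arg max_(x > [ffun=> nseq_tuple r false]) F x].
  have max_x1 x : F x <= F x1 by rewrite /x1; case: arg_maxnP => // y _; apply.
  exists x1; rewrite -/(F x1) -(@leq_pmul2r (2 ^ (r * k))) ?expn_gt0 //.
  apply: leq_trans avg _; rewrite -mulnA leq_mul2l /=.
  have -> : 2 ^ (r * k) = #|{: {ffun 'I_k -> elt r}}|.
    by rewrite card_ffun card_tuple card_bool card_ord expnM.
  by rewrite mulnC -sum_nat_const; apply: leq_sum.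
have few : 2 * Q * 2 ^ (r * k) <= 7 * \sum_x #|[pred rho | few_errors x rho]|.
  have -> : 2 ^ (r * k) = #|{: {ffun 'I_k -> elt r}}|.
    by rewrite card_ffun card_tuple card_bool card_ord expnM.
  rewrite mulnC -sum_nat_const big_distrr /=; apply: leq_sum => x _.
  exact: often_few_errors.
pose H x := #|[pred rho | few_errors x rho && (sharing x rho <= T)]|.
have uninf : 64 * \sum_x H x <= Q * 2 ^ (r * k).
  rewrite /H; under eq_bigr do rewrite -sum1_card.
  rewrite (exchange_big_dep predT) //= big_distrr /= -sum_nat_const.
  apply: leq_sum => rho _; rewrite sum1_card; apply: leq_trans (few_uninformative rho).
  by rewrite leq_mul2l; apply/eq_leq/eq_card.
have split x : #|[pred rho | few_errors x rho]| <= F x + H x.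
  rewrite /F /H -cardUI; apply: leq_trans (leq_addr _ _).
  by apply/subset_leq_card/subsetP => rho; rewrite !inE; case: ltnP => //= _ ->.
have : \sum_x #|[pred rho | few_errors x rho]| <= \sum_x F x + \sum_x H x.
  by rewrite -big_split; apply: leq_sum.
move: (\sum_x F x) (\sum_x H x) (\sum_x #|_|) (2 ^ _) few uninf => SF SH S q.
rewrite -!mulnA; move: (Q * q); lia.
Qed.

End Encoding.

(** * Correctness and security as counts of coin sequences *)

Section Probabilities.

Local Open Scope ring_scope.

Variables (R : realType) (P : problem) (w m : nat) (D : data_structure P w m).

Let coin_sequences := #|{: (coins D).-tuple bool}|.

Lemma coin_sequences_gt0 : (0 < coin_sequences)%N.
Proof. by rewrite /coin_sequences card_tuple card_bool expn_gt0. Qed.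

Lemma failure_count (y : seq (op P)) l i a :
  failure_probability_le D (1 / 3 : R) ->
  correct_answers y = Some l -> nth None l i = Some a ->
  (3 * #|[pred rho | nth None (answers D y rho) i != Some a]| <= coin_sequences)%N.
Proof.
move=> fail yE aE; have := fail y l yE i a aE; rewrite /Pr -/coin_sequences.
rewrite ler_pdivlMr ?ltr0n ?coin_sequences_gt0 //.
have := cardC [pred rho | nth None (answers D y rho) i == Some a].
rewrite -/coin_sequences; set G := #|[pred rho | _ == _]|; set B := #|[predC _]|.
move=> <- le_G; change (3 * B <= G + B)%N.
have : 2 * (G + B)%:R <= 3 * G%:R :> R by move: le_G; rewrite -/G; lra.
by rewrite -!natrM ler_nat; lia.
Qed.

Lemma secure_count (d M : nat) (y z : seq (op P)) (f : seq (seq 'I_(cells D)) -> bool) :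
  secure R D d -> valid y -> valid z -> size y = M -> size z = M ->
  computable_within (time_bound P w d M) M f ->
  (4 * #|[pred rho | f (probes D z rho)]|
     <= 4 * #|[pred rho | f (probes D y rho)]| + coin_sequences)%N.
Proof.
move=> sec vy vz sy sz cf; have := sec M y z vy vz sy sz f cf.
rewrite /Pr -/coin_sequences -mulrBl ler_norml => /andP[+ _].
rewrite ler_pdivlMr ?ltr0n ?coin_sequences_gt0 //.
set Y := #|_|; set Z := #|_| => le_YZ.
change (4 * Z <= 4 * Y + coin_sequences)%N.
by rewrite -(ler_nat R) natrD !natrM; lra.
Qed.

End Probabilities.

(** All terms have degree at most 3 in the base on the right. This base is at least 5, so six
    further factors absorb the constants; hence the exponent 9. *)
Lemma distinguisher_time (L n r w t : nat) :
  0 < n -> 0 < w -> 0 < r -> r <= L -> t <= r * n ->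
  3 * n + t + (n * n * r + n + 1) * 1000 <= (n + w + L + 2) ^ 9.
Proof.
move=> n_gt0 w_gt0 r_gt0 le_rL le_t; set B := _ + 2.
have le_nB : n <= B by rewrite /B; lia.
have le_rB : r <= B by rewrite /B; lia.
have B5 : 5 <= B by rewrite /B; lia.
have nnr : n * n * r <= B ^ 3 by rewrite !expnS expn0 muln1 mulnA !leq_mul.
have le1 : 1 <= B ^ 3 by rewrite expn_gt0; lia.
have le2 : n <= B ^ 3 by apply: leq_trans le_nB _; rewrite -{1}(expn1 B) leq_pexp2l //; lia.
have le3 : r * n <= B ^ 3.
  apply: (@leq_trans (B ^ 2)); last by rewrite leq_pexp2l //; lia.
  by rewrite expnS expn1 leq_mul.
have big : 5 ^ 6 <= B ^ 6 by rewrite leq_exp2r.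
rewrite (_ : 9 = 6 + 3) // expnD.
apply: leq_trans (leq_mul big (leqnn (B ^ 3))).
move: (B ^ 3) nnr le1 le2 le3 => c nnr le1 le2 le3.
rewrite (_ : 5 ^ 6 = 125 * 125) //; lia.
Qed.

(** The distinguisher accepts the informative sequence [z] with probability at least 121/448.
    Security costs 1/4 and overlong runs on [y] cost 1/100, which leaves at least 1/100. *)
Lemma shared_often (R : realType) (P : problem) (w m : nat) (D : data_structure P w m)
    (n r i k : nat) (y : seq (op P)) :
  0 < r -> 0 < w -> 0 < m -> 3780 * m <= r * k -> r <= up_log 2 #|op P| ->
  hard_instance P n r i k ->
  failure_probability_le D (1 / 3 : R)%R -> secure R D 9 ->
  size y = n -> valid y ->
  100 * #|[pred rho | n * n * r < sumn (map size (probes D y rho))]|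
    <= #|{: (coins D).-tuple bool}| ->
  #|{: (coins D).-tuple bool}|
    <= 100 * #|[pred rho | (r * k) %/ (3780 * w) < shared i k (probes D y rho)]|.
Proof.
move=> r_gt0 w_gt0 m_gt0 m_small le_r.
move=> [pre [ins [qry [suf [g [[size_pre size_ins size_qry size_n] [inj_g ans_x]]]]]]].
move=> fail sec size_y valid_y few_long.
set T := (r * k) %/ _; set Q := #|{: _}| in few_long *.
have correct x j : 3 * #|[pred rho : (coins D).-tuple bool |
    block_answer i pre ins qry suf x rho j != Some (g j (x j))]| <= Q.
  by have [l lE nth_l] := ans_x x; apply: (failure_count fail lE (nth_l j)).
have [x] := exists_informative_input size_pre size_ins size_qry inj_g r_gt0 w_gt0
  m_gt0 m_small correct.
rewrite -/T -/Q => informative.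
pose z := block_sequence pre ins qry suf x.
have size_z : size z = n by rewrite !size_cat size_pre size_ins size_qry -size_n !addnA.
have valid_z : valid z by have [l lE _] := ans_x x; rewrite /valid /z lE.
(* The encoding has one terminator per operation, so [f] accepts on length exactly the runs with
   more than [n * n * r] probes. *)
pose f (X : seq (seq 'I_(cells D))) := (n * n * r + n < size (encode X)) || (T < shared i k X).
have comp_f : computable_within (time_bound P w 9 n) n f.
  apply: computable_distinguisher; first by lia.
  have k_gt0 : 0 < k by case: posnP m_small => // ->; rewrite muln0; lia.
  apply: distinguisher_time => //; first by lia.
  apply: leq_trans (leq_div _ _) _; rewrite leq_mul2l; apply/orP; right; lia.
have := secure_count sec valid_y valid_z size_y size_z comp_f; rewrite -/Q => sec_f.
have fz : #|[pred rho : (coins D).-tuple bool |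
    T < sharing i pre ins qry suf x rho]| <= #|[pred rho | f (probes D z rho)]|.
  by apply/subset_leq_card/subsetP => rho; rewrite !inE /f => ->; rewrite orbT.
have fy : #|[pred rho | f (probes D y rho)]| <=
    #|[pred rho | n * n * r < sumn (map size (probes D y rho))]| +
    #|[pred rho | T < shared i k (probes D y rho)]|.
  rewrite -cardUI; apply: leq_trans (leq_addr _ _).
  apply/subset_leq_card/subsetP => rho; rewrite !inE /f size_encode.
  by rewrite [size (probes _ _ _)]size_map size_execute size_y ltn_add2r.
move: few_long informative sec_f fz fy; lia.
Qed.

(** * Summation over the binary tree of blocks *)

Section Tree.

Variable K : nat.
Implicit Types X : seq (seq 'I_K).

Fixpoint tree_shared (h i : nat) X : nat :=
  if h is h'.+1 then
    tree_shared h' i X + tree_shared h' (i + 2 ^ h') X + shared i (2 ^ h') X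
  else 0.

(** The number of distinct cells strengthens the induction: by inclusion-exclusion, the distinct
    cells of the two halves exceed those of the whole block by exactly the shared ones. *)
Lemma tree_shared_distinct h i X :
  tree_shared h i X + #|[pred a | a \in probed_at X i (2 ^ h)]|
    <= size (probed_at X i (2 ^ h)).
Proof.
elim: h i => [|h IH] i; first exact: card_size.
have -> : probed_at X i (2 ^ h.+1) =
    probed_at X i (2 ^ h) ++ probed_at X (i + 2 ^ h) (2 ^ h).
  by rewrite /probed_at expnS mul2n -addnn takeD drop_drop [_ + i]addnC flatten_cat.
rewrite size_cat /=; have := IH i; have := IH (i + 2 ^ h).
set l1 := probed_at X i _; set l2 := probed_at X _ _.
have := cardUI [pred a | a \in l1] [pred a | a \in l2].
have -> : #|[predU [pred a | a \in l1] & [pred a | a \in l2]]| = #|[pred a | a \in l1 ++ l2]|.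
  by apply: eq_card => a; rewrite !inE mem_cat.
have -> : #|[predI [pred a | a \in l1] & [pred a | a \in l2]]| = shared i (2 ^ h) X.
  by apply: eq_card => a; rewrite !inE.
move=> cardU le2 le1; apply: leq_trans (leq_add le1 le2).
by rewrite addnACA -cardU addnAC addnA.
Qed.

Lemma tree_shared_probes h X : tree_shared h 0 X <= sumn (map size X).
Proof.
apply: leq_trans (leq_addr _ _) (leq_trans (tree_shared_distinct h 0 X) _).
rewrite /probed_at drop0 -size_flatten -{2}(cat_take_drop (2 ^ h) X) flatten_cat size_cat.
exact: leq_addr.
Qed.

(** The levels whose halves have at least [2 ^ h0] operations number [h - h0], and each contributes
    the same total. Inner nodes start at even positions, as the assumed bound requires. *)
Lemma sum_tree_shared (I : finType) (X : I -> seq (seq 'I_K)) (n r C h0 : nat) :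
  (forall h i, h0 <= h -> ~~ odd i -> i + 2 ^ h + 2 ^ h <= n ->
    r * 2 ^ h * #|I| <= C * \sum_rho shared i (2 ^ h) (X rho)) ->
  forall h i, (0 < h -> ~~ odd i) -> i + 2 ^ h <= n ->
    r * 2 ^ h * (h - h0) * #|I| <= 2 * C * \sum_rho tree_shared h i (X rho).
Proof.
move=> level; elim=> [|h IH] i even_i le_n; first by rewrite sub0n muln0 mul0n.
rewrite expnS mul2n -addnn addnA in le_n.
have [lt_h|le_h] := ltnP h h0.
  by rewrite (_ : h.+1 - h0 = 0) ?muln0 ?mul0n //; lia.
have {}even_i := even_i isT.
have even_right : 0 < h -> ~~ odd (i + 2 ^ h).
  by case: h {IH le_n le_h} => // h _; rewrite oddD (negbTE even_i) oddX.
have right := IH (i + 2 ^ h) even_right le_n.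
have left := IH i (fun _ => even_i) (leq_trans (leq_addr _ _) le_n).
have top := level h i le_h even_i le_n.
have -> : r * 2 ^ h.+1 * (h.+1 - h0) * #|I| =
    r * 2 ^ h * (h - h0) * #|I| + r * 2 ^ h * (h - h0) * #|I| + 2 * (r * 2 ^ h * #|I|).
  by rewrite subSn // expnS; lia.
rewrite /= !big_split /= ![in leqRHS]mulnDr.
by rewrite !leq_add // -[leqRHS]mulnA leq_mul2l top.
Qed.

End Tree.

(** If [h0] is positive, its minimality makes [n * r / m] less than [2 ^ (s + 14)] for [s] useful
    levels, and the threshold on [n * r] forces [s] above 14, so that [s + 14 <= 2 * s]. If [h0] is
    0, every level is useful and the assumption on [r] bounds [n * r / m] by [n ^ e.+1]. *)
Lemma levels_bound (n m r e h0 : nat) :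
  0 < m -> 0 < r -> r <= m * n ^ e -> 2 ^ (28 * e.+1) * m <= n * r ->
  (0 < h0 -> r * 2 ^ h0.-1 < 3780 * m) ->
  n * r <= m * 2 ^ (2 * e.+1 * (trunc_log 2 n - h0)).
Proof.
move=> m_gt0 r_gt0 le_r le_nr min_h0.
have le_nre : n * r <= m * n ^ e.+1.
  by rewrite expnS mulnCA leq_mul2l le_r orbT.
have big_n : 2 ^ 28 <= n.
  rewrite -(@leq_exp2r _ _ e.+1) // -expnM -(leq_pmul2l m_gt0) mulnC.
  exact: leq_trans le_nr le_nre.
have n_gt0 : 0 < n by apply: leq_trans big_n; rewrite expn_gt0.
set H := trunc_log 2 n; have lt_nH : n < 2 ^ H.+1 by apply: trunc_log_ltn.
case: h0 min_h0 => [_|h0 /(_ isT) /= min_h0].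
  apply: leq_trans le_nre _; rewrite subn0 leq_mul2l; apply/orP; right.
  rewrite mulnAC expnM; apply: leq_expn2r; apply: leq_trans (ltnW lt_nH) _.
  rewrite leq_exp2l //.
  have : 28 < H.+1 by rewrite -(@ltn_exp2l 2) // (leq_ltn_trans big_n).
  lia.
have big : 2 ^ 28 * m <= n * r.
  apply: leq_trans le_nr; rewrite leq_mul2r leq_exp2l // ; apply/orP; right; lia.
have num : 3780 <= 2 ^ 12 by [].
have small : r * 2 ^ h0 < 2 ^ 12 * m.
  by apply: leq_trans min_h0 _; rewrite leq_mul2r num orbT.
(* With no level above [h0], [n * r] would be below [2 ^ 13 * m]. *)
have [le_Hh|lt_hH] := leqP H h0.
  have : n * r < 2 ^ 13 * m.
    apply: (@leq_ltn_trans (2 * (r * 2 ^ h0))); last first.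
      by rewrite (expnS 2 12) -mulnA ltn_pmul2l.
    rewrite mulnCA -expnS mulnC leq_mul2l; apply/orP; right.
    by apply: leq_trans (ltnW lt_nH) _; rewrite leq_exp2l.
  by move=> /(leq_ltn_trans big); rewrite ltn_pmul2r // ltn_exp2l.
set s := H - h0.+1.
have bound : n * r < m * 2 ^ (s + 14).
  apply: (@leq_ltn_trans (2 ^ H.+1 * r)); first by rewrite leq_mul2r (ltnW lt_nH) orbT.
  have -> : H.+1 = (s + 2) + h0 by rewrite /s; lia.
  rewrite (_ : s + 14 = (s + 2) + 12); last by lia.
  rewrite [2 ^ (s + 2 + h0)]expnD [2 ^ (s + 2 + 12)]expnD -[ltnLHS]mulnA.
  rewrite [m * _]mulnCA.
  by rewrite ltn_pmul2l ?expn_gt0 // [m * _]mulnC [_ * r]mulnC.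
have gt_s : 14 < s.
  have : 2 ^ 28 * m < m * 2 ^ (s + 14) by apply: leq_ltn_trans big bound.
  by rewrite mulnC ltn_pmul2l // ltn_exp2l //; lia.
apply: leq_trans (ltnW bound) _; rewrite leq_mul2l leq_exp2l //; apply/orP; right.
rewrite mulnAC; apply: (@leq_trans (2 * s)); first by lia.
exact: leq_pmulr.
Qed.

(** * From shared cells to amortized running time *)

Local Open Scope ring_scope.

(* The constants hidden in the Omega are c and the threshold b on nr/m.
   The security exponent d depends on nothing; c and b may depend only on the
   exponent e for which r <= m n^e, i.e. on how r/m compares polynomially to n. *)
Theorem theorem3 (R : realType) :
  exists d : nat, forall e : nat, exists c b : R, 0 < c /\
  forall (kind : ds_kind) (n r u w m : nat)
         (D : data_structure (problem_of kind n u r) w m),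
    (1 <= r)%N -> (1 <= w)%N -> (1 <= m)%N -> (n <= u)%N ->
    (r <= m * n ^ e)%N ->
    b <= n%:R * r%:R / m%:R ->
    failure_probability_le D (1 / 3 : R) ->
    secure R D d ->
    exists y : seq (op (problem_of kind n u r)),
      [/\ size y = n, valid y &
          c * (lg (n%:R * r%:R / m%:R) * (r%:R / w%:R))
            <= expected_amortized_time R D y].
Proof.
exists 9%N => e.
(* The factor 3780 comes from the number of shared cells, 100 from their probability. An abstract
   [C] keeps this unary number from being computed. *)
have [C CE] : exists C, C = (3780 * 100)%N by exists (3780 * 100)%N.
have C_gt0 : (0 < C)%N by rewrite CE.
exists (4 * C * (2 * e.+1))%:R^-1, (2 ^ (28 * e.+1))%:R; split.
  by rewrite invr_gt0 ltr0n !muln_gt0 C_gt0.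
move=> kind n r u w m D r_gt0 w_gt0 m_gt0 le_nu le_r.
rewrite ler_pdivlMr ?ltr0n // -!natrM ler_nat => le_nr fail sec.
have n_gt0 : (0 < n)%N.
  by case: n le_nr {D le_nu le_r fail sec} => //; rewrite mul0n leqNgt muln_gt0 m_gt0 expn_gt0.
have u_gt0 := leq_trans n_gt0 le_nu.
pose Q := #|{: (coins D).-tuple bool}|.
have Q_gt0 : (0 < Q)%N := coin_sequences_gt0 D.
(* Any permitted sequence of length [n] serves as [y]; a hard instance with empty blocks provides
   one. *)
have [y size_y valid_y] : exists2 y : seq (op (problem_of kind n u r)), size y = n & valid y.
  have [|pre [ins [qry [suf [g [[sz0 sz1 sz2 sz3] [_ ans_x]]]]]]] :=
    @problem_hard kind n u r 0 0 n_gt0 le_nu isT; first by [].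
  have [l lE _] := ans_x [ffun=> nseq_tuple r false].
  exists (pre ++ ins [ffun=> nseq_tuple r false] ++ qry ++ suf); last by rewrite /valid lE.
  by rewrite !size_cat sz0 sz1 sz2; exact: sz3.
exists y; split=> //.
pose S := (\sum_rho sumn (map size (probes D y rho)))%N.
have ex_h0 : exists h, (3780 * m <= r * 2 ^ h)%N.
  by exists (3780 * m)%N; apply: leq_trans (ltnW (ltn_expl _ _)) (leq_pmull _ r_gt0).
case: (ex_minnP ex_h0) => h0 h0P h0_min.
pose H := trunc_log 2 n.
have le_2H : (2 ^ H <= n)%N by apply: trunc_logP.
have main : (r * n * (H - h0) * Q <= 4 * C * w * S)%N.
  (* If more than [n * n * r] probes occur with probability above 1/100, the expected number of
     probes already exceeds the claimed bound. *)
  have [few_long|many_long] := leqP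
      (100 * #|[pred rho | n * n * r < sumn (map size (probes D y rho))]|)%N Q; last first.
    have long : (n * n * r * #|[pred rho | n * n * r < sumn (map size (probes D y rho))]| <= S)%N.
      rewrite mulnC -sum_nat_const big_mkcond /=; apply: leq_sum => rho _.
      by case: ifP => // /ltnW.
    have le_Hn : (H - h0 <= n)%N.
      apply: leq_trans (leq_subr _ _) _.
      by apply: leq_trans le_2H; apply/ltnW/ltn_expl.
    apply: (@leq_trans (r * n * n * Q)); first by rewrite leq_mul2r leq_mul2l le_Hn !orbT.
    apply: (@leq_trans (100 * S)); last first.
      by rewrite leq_mul2r; apply/orP; right; move: (w) w_gt0; lia.
    apply: leq_trans (leq_mul (leqnn 100) long); rewrite mulnCA.
    have -> : (r * n * n = n * n * r)%N by lia.
    by rewrite leq_mul2l (ltnW many_long) orbT.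
  have node h i : (h0 <= h)%N -> ~~ odd i -> (i + 2 ^ h + 2 ^ h <= n)%N ->
      (r * 2 ^ h * Q <= C * w * \sum_rho shared i (2 ^ h) (probes D y rho))%N.
    move=> le_h even_i le_n.
    have m_small : (3780 * m <= r * 2 ^ h)%N.
      by apply: leq_trans h0P _; rewrite leq_mul2l leq_exp2l // le_h orbT.
    have := shared_often r_gt0 w_gt0 m_gt0 m_small (le_up_log_op kind n r u_gt0)
      (problem_hard kind r n_gt0 le_nu even_i le_n) fail sec size_y valid_y few_long.
    set T := ((r * 2 ^ h) %/ _)%N; set G := #|[pred rho | (T < _)%N]| => often.
    (* The strict inequality yields [T.+1] shared cells, which makes up for the floor in [T]. *)
    have sumG : (T.+1 * G <= \sum_rho shared i (2 ^ h) (probes D y rho))%N.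
      rewrite mulnC -sum_nat_const big_mkcond /=; apply: leq_sum => rho _.
      by case: ifP.
    have le_T : (r * 2 ^ h <= T.+1 * (3780 * w))%N.
      by apply/ltnW/ltn_ceil; rewrite muln_gt0.
    apply: leq_trans (leq_mul le_T often) _.
    have -> : (T.+1 * (3780 * w) * (100 * G) = C * w * (T.+1 * G))%N by rewrite CE; lia.
    by rewrite leq_mul2l sumG orbT.
  have := sum_tree_shared node (h := H) (i := 0) (fun=> isT) le_2H.
  set U := (\sum_rho _)%N => tree.
  have le_US : (U <= S)%N by apply: leq_sum => rho _; apply: tree_shared_probes.
  (* The tree covers only the first [2 ^ H] operations, at least half of all. *)
  have le_n : (n <= 2 * 2 ^ H)%N by rewrite -expnS ltnW // trunc_log_ltn.
  apply: (@leq_trans (2 * (r * 2 ^ H * (H - h0) * Q))).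
    have -> : (2 * (r * 2 ^ H * (H - h0) * Q) = r * (2 * 2 ^ H) * (H - h0) * Q)%N by lia.
    by rewrite !leq_mul2r leq_mul2l le_n !orbT.
  apply: (leq_trans (leq_mul (leqnn 2) tree)).
  have -> : (4 * C * w * S = 2 * (2 * (C * w) * S))%N by lia.
  by rewrite !leq_mul2l le_US !orbT.
have levels : (n * r <= m * 2 ^ (2 * e.+1 * (H - h0)))%N.
  apply: levels_bound => // h0_gt0; rewrite ltnNge; apply/negP => /h0_min.
  by rewrite leqNgt ltn_predL h0_gt0.
have Q_gt0R : 0 < Q%:R :> R by rewrite ltr0n.
have ln2_gt0 : 0 < ln 2 :> R by apply: ln_gt0; rewrite ltr1n.
have lg_le : lg ((n * r)%:R / m%:R) <= (2 * e.+1 * (H - h0))%:R :> R.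
  rewrite /lg ler_pdivrMr // [leRHS]mulr_natl -lnXn ?ltr0n //.
  rewrite ler_ln ?posrE ?exprn_gt0 ?divr_gt0 ?ltr0n ?muln_gt0 ?n_gt0 //.
  by rewrite ler_pdivrMr ?ltr0n // -natrX -natrM ler_nat [(_ * m)%N]mulnC.
have -> : expected_amortized_time R D y = S%:R / Q%:R / n%:R.
  by rewrite /expected_amortized_time size_y natr_sum.
rewrite ler_pdivlMr ?ltr0n // ler_pdivlMr //.
apply: (@le_trans _ _ ((4 * C * (2 * e.+1))%:R^-1 *
    ((2 * e.+1 * (H - h0))%:R * (r%:R / w%:R)) * n%:R * Q%:R)).
  rewrite ler_wpM2r ?ler0n // ler_wpM2r ?ler0n // ler_wpM2l ?invr_ge0 ?ler0n //.
  by rewrite ler_wpM2r // divr_ge0 ?ler0n.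
have -> : (4 * C * (2 * e.+1))%:R^-1 * ((2 * e.+1 * (H - h0))%:R * (r%:R / w%:R)) * n%:R * Q%:R
    = (r * n * (H - h0) * Q)%:R / (4 * C * w)%:R :> R.
  have C_neq0 : (4 * C)%:R != 0 :> R by rewrite pnatr_eq0 muln_eq0 -lt0n C_gt0.
  have w_neq0 : w%:R != 0 :> R by rewrite pnatr_eq0 -lt0n.
  have e_neq0 : (2 * e.+1)%:R != 0 :> R by rewrite pnatr_eq0.
  rewrite ![(4 * C * _)%:R]natrM ![(2 * e.+1 * _)%:R]natrM.
  rewrite ![(r * n * _ * Q)%:R]natrM ![(r * n * _)%:R]natrM.
  rewrite [(r * n)%:R]natrM.
  move: (4 * C)%:R w%:R (2 * e.+1)%:R C_neq0 w_neq0 e_neq0 => a b c a_neq0 b_neq0 c_neq0.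
  by field; rewrite a_neq0 b_neq0 c_neq0.
by rewrite ler_pdivrMr ?ltr0n ?muln_gt0 ?C_gt0 ?w_gt0 // -natrM ler_nat [(S * _)%N]mulnC.
Qed.
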